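(* Let $X$ be a point. Let $n,s\ge1$ and $k_1,\ldots,k_s\ge0$. Then $O^{k_1}(n)\circ\cdots\circ O^{k_s}(n)$ is a finite linear combination of expressions of the form $${\bf 1}_{-\left(n-\sum_{i=1}^{\ell(\pi)}\sum_{j=1}^{m_i-2r_i}n_{i,j}\right)}\prod_{i=1}^{\ell(\pi)}\left(\prod_{j=1}^{m_i-2r_i}\mathfrak p_{-n_{i,j}}\right)\cdot|0\rangle$$ where $\pi=\{\pi_1,\dots,\pi_{\ell(\pi)}\}$ runs over all partitions of the set $\{1,\ldots,s\}$, $m_i,r_i$ are non-negative integers such that $2r_i\le m_i\le2+\sum_{j\in\pi_i}k_j$, $0<n_{i,1}\le\ldots\le n_{i,m_i-2r_i}$, $\sum_{j=1}^{m_i-2r_i}n_{i,j}\le\sum_{j\in\pi_i}(k_j+1)$ for every $i$, and $$\sum_{i=1}^{\ell(\pi)}\left(m_i-2+\sum_{j=1}^{m_i-2r_i}n_{i,j}\right)=\sum_{i=1}^sk_i.$$ Moreover, all the coefficients in this linear combination are independent of $n$.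
   Context: When $X$ is a point, $H^*(X^n,S_n)=\mathbb Q[S_n]$ with $\circ$ the group algebra multiplication, and $H^*_{\rm orb}(X^n/S_n)$ is the subalgebra of elements invariant under conjugation (the center of $\mathbb Q[S_n]$). $\mathcal F_X=\bigoplus_{n\ge0}H^*_{\rm orb}(X^n/S_n)$ and $|0\rangle=1$ in the $n=0$ summand. For $m>0$ the operator $\mathfrak p_{-m}=\mathfrak p_{-m}(1_X)\in{\rm End}(\mathcal F_X)$ sends $y\in H^*_{\rm orb}(X^k/S_k)$ to $\frac1{m!\,k!}\sum_{g\in S_{m+k}}g\,(\omega_m\otimes y)\,g^{-1}$, where $\omega_m$ is $m$ times the sum of all $m$-cycles in $S_m$ and $\omega_m\otimes y\in\mathbb Q[S_m\times S_k]\subset\mathbb Q[S_{m+k}]$. ${\bf 1}_{-k}=\mathfrak p_{-1}^k/k!$ if $k\ge0$, and ${\bf 1}_{-k}=0$ if $k<0$. $\xi_j=\sum_{i<j}(i,j)\in\mathbb Q[S_n]$, $1\le j\le n$, are the Jucys–Murphy elements and $O^k(n)=\sum_{i=1}^n(-\xi_i)^k\in H^*_{\rm orb}(X^n/S_n)$. For a set partition $\pi$, $\ell(\pi)$ denotes the number of its blocks. *)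

(* Defs.v *)
From HB Require Import structures.
From mathcomp Require Import all_boot all_order all_algebra all_fingroup.
From mathcomp Require Import zify boolp.

Set Implicit Arguments.
Unset Strict Implicit.
Unset Printing Implicit Defensive.

Import GRing.Theory.
Local Open Scope ring_scope.

(* The group algebra of a finite group, under the convolution product.  The
   alias hides the pointwise ring structure of {ffun gT -> R}. *)
Definition galg (R : comNzRingType) (gT : finGroupType) := {ffun gT -> R}.

HB.lock Definition galg_mul (R : comNzRingType) (gT : finGroupType)
    (x y : galg R gT) : galg R gT :=
  [ffun g => \sum_h x h * y (h^-1 * g)%g].

Section GroupAlgebra.
Variables (R : comNzRingType) (gT : finGroupType).
Local Notation A := (galg R gT).
Implicit Types (x y z : A) (g h : gT).

HB.instance Definition _ := GRing.Lmodule.copy A {ffun gT -> R^o}.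

Definition galg_of g : A := [ffun h => (h == g)%:R].

Lemma galg_mulE x y g : galg_mul x y g = \sum_h x h * y (h^-1 * g)%g.
Proof. by rewrite galg_mul.unlock ffunE. Qed.

Fact galg_mulA : associative (@galg_mul R gT).
Proof.
move=> x y z; apply/ffunP=> g; rewrite !galg_mulE.
under eq_bigr => k _ do rewrite galg_mulE mulr_sumr.
under [RHS]eq_bigr => h _ do rewrite galg_mulE mulr_suml.
rewrite [RHS]exchange_big /=; apply: eq_bigr => k _.
rewrite [RHS](reindex_inj (mulgI k)) /=; apply: eq_bigr => h _.
by rewrite mulrA mulKg invMg mulgA.
Qed.

Fact galg_mul1 : left_id (galg_of 1%g) (@galg_mul R gT).
Proof.
move=> x; apply/ffunP=> g; rewrite galg_mulE (bigD1 1%g) //= big1 => [|h /negPf hN].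
  by rewrite ffunE eqxx mul1r invg1 mul1g addr0.
by rewrite ffunE hN mul0r.
Qed.

Fact galg_mulr1 : right_id (galg_of 1%g) (@galg_mul R gT).
Proof.
move=> x; apply/ffunP=> g; rewrite galg_mulE (bigD1 g) //= big1 => [|h hN].
  by rewrite ffunE mulVg eqxx mulr1 addr0.
by rewrite ffunE -eq_mulVg1 (negPf hN) mulr0.
Qed.

Fact galg_mulDl : left_distributive (@galg_mul R gT) +%R.
Proof.
move=> x y z; apply/ffunP=> g; rewrite ffunE !galg_mulE -big_split /=.
by apply: eq_bigr => h _; rewrite ffunE mulrDl.
Qed.

Fact galg_mulDr : right_distributive (@galg_mul R gT) +%R.
Proof.
move=> x y z; apply/ffunP=> g; rewrite ffunE !galg_mulE -big_split /=.
by apply: eq_bigr => h _; rewrite ffunE mulrDr.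
Qed.

Fact galg_1_neq0 : galg_of 1%g != 0.
Proof. by apply/eqP=> /ffunP/(_ 1%g)/eqP; rewrite !ffunE eqxx oner_eq0. Qed.

HB.instance Definition _ := GRing.Zmodule_isNzRing.Build A
  galg_mulA galg_mul1 galg_mulr1 galg_mulDl galg_mulDr galg_1_neq0.

Lemma galg_scaleE (a : R) x g : (a *: x) g = a * x g.
Proof. exact: ffunE. Qed.

Fact galg_scalerAl (a : R) x y : a *: (x * y) = (a *: x) * y.
Proof.
apply/ffunP=> g; rewrite galg_scaleE !galg_mulE mulr_sumr; apply: eq_bigr => h _.
by rewrite galg_scaleE mulrA.
Qed.

HB.instance Definition _ := GRing.Lmodule_isLalgebra.Build R A galg_scalerAl.

Fact galg_scalerAr (a : R) x y : a *: (x * y) = x * (a *: y).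
Proof.
apply/ffunP=> g; rewrite galg_scaleE !galg_mulE mulr_sumr; apply: eq_bigr => h _.
by rewrite galg_scaleE mulrCA.
Qed.

HB.instance Definition _ := GRing.Lalgebra_isAlgebra.Build R A galg_scalerAr.

Lemma galg_of1 : galg_of 1%g = 1. Proof. by []. Qed.

Lemma galg_ofM g h : galg_of (g * h)%g = galg_of g * galg_of h.
Proof.
apply/ffunP=> k; rewrite galg_mulE ffunE (bigD1 g) //= big1 => [|j /negPf jN].
  by rewrite !ffunE eqxx mul1r addr0 -(inj_eq (mulgI g) (_ * k)%g) mulKVg.
by rewrite ffunE jN mul0r.
Qed.

Lemma galg_sum x : x = \sum_g x g *: galg_of g.
Proof.
apply/ffunP=> g; rewrite sum_ffunE (bigD1 g) //= big1 => [|h hN].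
  by rewrite galg_scaleE !ffunE eqxx addr0 mulr1.
by rewrite galg_scaleE !ffunE eq_sym (negPf hN) mulr0.
Qed.

Definition conj_inv : {pred A} :=
  fun x => [forall g, galg_of g * x * galg_of g^-1 == x].

Lemma conj_invP x :
  reflect (forall g, galg_of g * x = x * galg_of g) (x \in conj_inv).
Proof.
apply: (iffP forallP) => /= xI g.
  by rewrite -{2}(eqP (xI g)) -mulrA -galg_ofM mulVg mulr1.
by rewrite xI -mulrA -galg_ofM mulgV mulr1.
Qed.

Fact conj_inv_subalg : GRing.subalg_closed conj_inv.
Proof.
split=> [|a x y /conj_invP xI /conj_invP yI|x y /conj_invP xI /conj_invP yI].
- by apply/conj_invP=> g; rewrite mulr1 mul1r.
- by apply/conj_invP=> g; rewrite mulrDl mulrDr yI -scalerAl -scalerAr xI.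
- by apply/conj_invP=> g; rewrite mulrA xI -mulrA yI mulrA.
Qed.

HB.instance Definition _ :=
  GRing.isSubalgClosed.Build R A conj_inv (GRing.subalg_closed_semi conj_inv_subalg).

Lemma conj_inv_comm x y : x \in conj_inv -> x * y = y * x.
Proof.
move/conj_invP=> xI; rewrite [y]galg_sum mulr_sumr mulr_suml.
by apply: eq_bigr => g _; rewrite -scalerAl -scalerAr xI.
Qed.

Lemma conj_inv_trace x :
  \sum_g galg_of g * x * galg_of g^-1 \in conj_inv.
Proof.
apply/conj_invP=> h; rewrite mulr_sumr mulr_suml.
rewrite [RHS](reindex_inj (mulgI h)) /=; apply: eq_bigr => g _.
by rewrite invMg !galg_ofM -!mulrA -galg_ofM mulVg mulr1 !mulrA.
Qed.
End GroupAlgebra.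

(* The orbifold cohomology ring of X^n/S_n for X a point: the conjugation
   invariants of Q[S_n].  Products in 'S_n compose from left to right; the
   opposite convention gives the same product on conjugation invariants and the
   same operators below. *)
Record orbring (n : nat) := OrbRing {
  orbval :> galg rat 'S_n;
  orbvalP : orbval \in @conj_inv rat 'S_n }.

Section OrbRing.
Variable n : nat.

HB.instance Definition _ := [isSub for @orbval n].
HB.instance Definition _ := [Choice of orbring n by <:].
HB.instance Definition _ := [SubChoice_isSubAlgebra of orbring n by <:].

Fact orbring_mulC : commutative (@GRing.mul (orbring n)).
Proof. by move=> x y; apply/val_inj/conj_inv_comm/orbvalP. Qed.

HB.instance Definition _ :=
  GRing.PzRing_hasCommutativeMul.Build (orbring n) orbring_mulC.
End OrbRing.

Lemma power2_comm (R : nzRingType) (s u v : R) k :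
    u * v = v * u -> s * (u + v) = (u + v) * s -> s * (u * v) = u * v * s ->
  s * (u ^+ k + v ^+ k) = (u ^+ k + v ^+ k) * s.
Proof.
move=> uv c1 c2; have newton m : u ^+ m.+2 + v ^+ m.+2 =
    (u + v) * (u ^+ m.+1 + v ^+ m.+1) - u * v * (u ^+ m + v ^+ m).
  have e1 : u * v * u ^+ m = v * u ^+ m.+1 by rewrite uv exprS mulrA.
  have e2 : u * v * v ^+ m = u * v ^+ m.+1 by rewrite -mulrA -exprS.
  rewrite mulrDl !mulrDr e1 e2 -!exprS opprD -!addrA; congr (_ + _).
  by rewrite [X in _ + X]addrA addrACA subrr add0r addrC subrK.
elim/ltn_ind: k => -[|[|k]] IHk.
- by rewrite !expr0 mulrDl mulrDr mulr1 mul1r.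
- by rewrite !expr1.
rewrite newton mulrBr mulrBl (mulrA s (u + v)) c1 (mulrA s (u * v)) c2.
by rewrite -!(mulrA _ s) !IHk // !mulrA.
Qed.

Section JucysMurphy.
Variable n : nat.
Local Notation e := (@galg_of rat 'S_n).

(* Indices in 'I_n start at 0, so jucys_murphy j is xi_(j + 1). *)
Definition jucys_murphy (j : 'I_n) : galg rat 'S_n :=
  \sum_(i < n | (i < j)%N) e (tperm i j).

Local Notation xi := jucys_murphy.

Lemma jucys_murphy_comm (g : 'S_n) (j : 'I_n) :
  g j = j -> (forall i, (g i < j)%N = (i < j)%N) -> e g * xi j = xi j * e g.
Proof.
move=> gj gi; rewrite mulr_sumr mulr_suml (reindex_inj (@perm_inj _ g)) /=.
apply: eq_big => [i|i _]; first exact: gi.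
by rewrite -!galg_ofM [in RHS]conjgC tpermJ gj.
Qed.

Lemma jucys_murphy_commute (i j : 'I_n) :
  (i < j)%N -> xi i * xi j = xi j * xi i.
Proof.
move=> ij; rewrite mulr_suml mulr_sumr; apply: eq_bigr => l li.
have lj := ltn_trans li ij.
apply: jucys_murphy_comm => [|h]; first by rewrite tpermD ?neq_ltn ?lj ?ij.
by case: tpermP => [->|->|//]; rewrite ?lj ?ij.
Qed.

Section Adjacent.
Variables (a b : 'I_n).
Hypothesis ab : b = a.+1 :> nat.
Let s : galg rat 'S_n := e (tperm a b).

Let ss : s * s = 1. Proof. by rewrite -galg_ofM tperm2. Qed.

Let sx : s * xi a = xi b * s - 1.
Proof.
have -> : xi b = s + \sum_(i < n | (i < a)%N) e (tperm i b).
  rewrite /jucys_murphy (bigD1 a) /= ?ab //; congr (_ + _).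
  apply: eq_bigl => i; rewrite ltnS -(inj_eq val_inj) /=.
  by rewrite [RHS]ltn_neqAle andbC.
rewrite mulrDl ss addrAC subrr add0r mulr_sumr mulr_suml.
apply: eq_bigr => i ia; rewrite -!galg_ofM; congr e.
have ib : (i < b)%N by rewrite ab ltnW.
by rewrite [in RHS]conjgC tpermJ tpermR tpermD // neq_ltn ?ia ?ib ?orbT.
Qed.

Let sy : s * xi b = xi a * s + 1.
Proof.
have := congr1 (fun z => s * z * s) sx.
rewrite mulrA ss mul1r mulrBr mulrBl mulr1 ss => ->.
by rewrite -!mulrA ss mulr1 subrK.
Qed.

Let power2 k : s * ((- xi a) ^+ k + (- xi b) ^+ k) =
               ((- xi a) ^+ k + (- xi b) ^+ k) * s.
Proof.
have xy : xi a * xi b = xi b * xi a.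
  by apply: jucys_murphy_commute; rewrite ab.
have c1 : s * (xi a + xi b) = (xi a + xi b) * s.
  by rewrite mulrDr sx sy mulrDl addrC -addrA (addrC 1) subrK.
have c2 : s * (xi a * xi b) = (xi a * xi b) * s.
  rewrite mulrA sx mulrBl -(mulrA _ s) sy mulrDr mul1r mulr1 addrK.
  by rewrite mulrA xy.
apply: power2_comm; first by rewrite !mulrNN.
  by rewrite -opprD mulrN c1 mulNr.
by rewrite mulrNN.
Qed.

Lemma power_sum_adjacent k :
  s * (\sum_(i < n) (- xi i) ^+ k) = (\sum_(i < n) (- xi i) ^+ k) * s.
Proof.
have aNb : b != a by rewrite -(inj_eq val_inj) /= ab neq_ltn ltnSn orbT.
rewrite (bigD1 a) //= (bigD1 b) //= addrA mulrDr mulrDl power2; congr (_ + _).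
rewrite mulr_sumr mulr_suml; apply: eq_bigr => i /andP[iNa iNb].
apply: commrX; apply: commrN; apply: jucys_murphy_comm => [|h].
  by rewrite tpermD // eq_sym.
have iNa' : i != a :> nat by rewrite (inj_eq val_inj).
have iNb' : i != b :> nat by rewrite (inj_eq val_inj).
by case: tpermP => [->|->|//]; lia.
Qed.
End Adjacent.

Lemma power_sum_conj_inv k :
  \sum_(i < n) (- xi i) ^+ k \in @conj_inv rat 'S_n.
Proof.
set p := \sum_(i < n) _.
pose C := [set g : 'S_n | e g * p == p * e g].
have gC : group_set C.
  apply/group_setP; split=> [|g h]; rewrite !inE.
    by rewrite galg_of1 mul1r mulr1.
  by move=> /eqP gp /eqP hp; rewrite !galg_ofM -mulrA hp mulrA gp mulrA.
have tC d : forall a b : 'I_n, b = (a + d)%N :> nat -> tperm a b \in C.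
  elim: d => [|d IHd] a b abd.
    have -> : b = a by apply: val_inj; rewrite /= abd addn0.
    by rewrite tperm1 (group1 (group gC)).
  have ltcn : (a + d < n)%N by have := ltn_ord b; lia.
  pose c := Ordinal ltcn.
  have tac := IHd a c erefl.
  have tcb : tperm c b \in C.
    by rewrite inE; apply/eqP/power_sum_adjacent; rewrite abd addnS.
  have [->|cNa] := eqVneq a c; first by [].
  have -> : tperm a b = (tperm a c ^ tperm c b)%g.
    rewrite tpermJ tpermL tpermD //; first by rewrite eq_sym.
    by rewrite -(inj_eq val_inj) /= abd; lia.
  exact: (@groupJ _ (group gC)).
apply/conj_invP=> g; have [ts -> _] := prod_tpermP g.
have : (\prod_(t <- ts) tperm t.1 t.2)%g \in C.
  apply: (@group_prod _ (group gC)) => -[a b] _ /=.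
  have [ab|/ltnW ba] := leqP a b; first by apply: (tC (b - a)%N); lia.
  by rewrite tpermC; apply: (tC (a - b)%N); lia.
by rewrite inE => /eqP.
Qed.

(* The class O^k(n) = sum_i (-xi_i)^k. *)
Definition jm_power_sum (k : nat) : orbring n := OrbRing (power_sum_conj_inv k).
End JucysMurphy.

(* The Fock space, the direct sum over n of the rings orbring n. *)
Record fock := Fock {
  fock_comp :> forall n, orbring n;
  fock_finite : exists N, forall n, (N <= n)%N -> fock_comp n = 0 }.

Lemma fockP (x y : fock) : (forall n, x n = y n) -> x = y.
Proof.
case: x y => [x xF] [y yF] /= xy; have exy : x = y by apply: functional_extensionality_dep.
by case: _ / exy yF => yF; rewrite (Prop_irrelevance xF yF).
Qed.

Section FockLmodule.
Implicit Types (x y z : fock) (a b : rat).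

HB.instance Definition _ := gen_eqMixin fock.
HB.instance Definition _ := gen_choiceMixin fock.

Fact fock0_finite : exists N, forall n, (N <= n)%N -> 0 = 0 :> orbring n.
Proof. by exists 0%N. Qed.

Fact fock_add_finite x y :
  exists N, forall n, (N <= n)%N -> x n + y n = 0.
Proof.
have [[N xN] [M yM]] := (fock_finite x, fock_finite y).
by exists (maxn N M) => n; rewrite geq_max => /andP[/xN -> /yM ->]; rewrite addr0.
Qed.

Fact fock_opp_finite x : exists N, forall n, (N <= n)%N -> - x n = 0.
Proof. by have [N xN] := fock_finite x; exists N => n /xN ->; rewrite oppr0. Qed.

Fact fock_scale_finite a x : exists N, forall n, (N <= n)%N -> a *: x n = 0.
Proof. by have [N xN] := fock_finite x; exists N => n /xN ->; rewrite scaler0. Qed.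

Definition fock0 := Fock fock0_finite.
Definition fock_add x y := Fock (fock_add_finite x y).
Definition fock_opp x := Fock (fock_opp_finite x).
Definition fock_scale a x := Fock (fock_scale_finite a x).

Fact fock_addA : associative fock_add.
Proof. by move=> x y z; apply: fockP => n; apply: addrA. Qed.
Fact fock_addC : commutative fock_add.
Proof. by move=> x y; apply: fockP => n; apply: addrC. Qed.
Fact fock_add0 : left_id fock0 fock_add.
Proof. by move=> x; apply: fockP => n; apply: add0r. Qed.
Fact fock_addN : left_inverse fock0 fock_opp fock_add.
Proof. by move=> x; apply: fockP => n; apply: addNr. Qed.

HB.instance Definition _ :=
  GRing.isZmodule.Build fock fock_addA fock_addC fock_add0 fock_addN.

Fact fock_scaleA a b x : fock_scale a (fock_scale b x) = fock_scale (a * b) x.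
Proof. by apply: fockP => n; apply: scalerA. Qed.
Fact fock_scale1 : left_id 1 fock_scale.
Proof. by move=> x; apply: fockP => n; apply: scale1r. Qed.
Fact fock_scaleDr : right_distributive fock_scale +%R.
Proof. by move=> a x y; apply: fockP => n; apply: scalerDr. Qed.
Fact fock_scaleDl x : {morph fock_scale^~ x : a b / a + b}.
Proof. by move=> a b; apply: fockP => n; apply: scalerDl. Qed.

HB.instance Definition _ := GRing.Zmodule_isLmodule.Build rat fock
  fock_scaleA fock_scale1 fock_scaleDr fock_scaleDl.

Lemma fock_compD x y n : (x + y) n = x n + y n. Proof. by []. Qed.
Lemma fock_compZ a x n : (a *: x) n = a *: x n. Proof. by []. Qed.
End FockLmodule.

Lemma ecast_orbring_linear i j (ij : i = j) :
  linear (fun x : orbring i => ecast k (orbring k) ij x).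
Proof. by case: _ / ij. Qed.

Lemma ecast_orbring0 i j (ij : i = j) :
  ecast k (orbring k) ij (0 : orbring i) = 0.
Proof. by case: _ / ij. Qed.

Section FockInjection.
Variables (n : nat) (x : orbring n).

Definition fock_inj_comp (k : nat) : orbring k :=
  match n =P k with
  | ReflectT nk => ecast i (orbring i) nk x
  | ReflectF _ => 0
  end.

Fact fock_inj_finite : exists N, forall k, (N <= k)%N -> fock_inj_comp k = 0.
Proof.
exists n.+1 => k nk; rewrite /fock_inj_comp; case: eqP => // nEk.
by rewrite nEk ltnn in nk.
Qed.

Definition fock_inj : fock := Fock fock_inj_finite.
End FockInjection.

Definition vacuum : fock := fock_inj (1 : orbring 0).

(* The embedding of S_m x S_k in S_(m+k): s acts on the first m points and t on
   the last k. *)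
Section PermSum.
Variables (m k : nat) (s : 'S_m) (t : 'S_k).

Definition perm_sum_fun (i : 'I_(m + k)) : 'I_(m + k) :=
  match split i with inl a => lshift k (s a) | inr b => rshift m (t b) end.

Fact perm_sum_inj : injective perm_sum_fun.
Proof.
move=> i j; rewrite -[i]splitK -[j]splitK /perm_sum_fun !unsplitK.
case: (split i) (split j) => [a|a] [b|b] /= /eqP.
- by rewrite (inj_eq (@lshift_inj _ _)) => /eqP/perm_inj ->.
- by rewrite eq_lrshift.
- by rewrite eq_rlshift.
- by rewrite (inj_eq (@rshift_inj _ _)) => /eqP/perm_inj ->.
Qed.

Definition perm_sum : 'S_(m + k) := perm perm_sum_inj.
End PermSum.

Definition galg_tensor (m k : nat) (x : galg rat 'S_m) (y : galg rat 'S_k) :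
    galg rat 'S_(m + k) :=
  \sum_(s : 'S_m) \sum_(t : 'S_k) (x s * y t) *: galg_of rat (perm_sum s t).

(* For m > 0, s is an m-cycle iff it has a single orbit. *)
Definition omega (m : nat) : galg rat 'S_m :=
  m%:R *: \sum_(s : 'S_m | #|porbits s| == 1%N) galg_of rat s.

Definition conj_trace (n : nat) (x : galg rat 'S_n) : orbring n :=
  OrbRing (conj_inv_trace x).

Definition creation_comp (m k : nat) (y : orbring k) : orbring (m + k) :=
  (m`! * k`!)%:R^-1 *: conj_trace (galg_tensor (omega m) y).

Section Creation.
Variable m : nat.
Implicit Types y : fock.

Definition creation_fun_comp y (n : nat) : orbring n :=
  match (m + (n - m))%N =P n with
  | ReflectT mn => ecast i (orbring i) mn (creation_comp m (y (n - m)%N))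
  | ReflectF _ => 0
  end.

Lemma creation_comp_is_linear k : linear (@creation_comp m k).
Proof.
move=> a x y; rewrite /creation_comp scalerA [a * _]mulrC -scalerA -scalerDr.
congr (_ *: _); apply: val_inj => /=; rewrite scaler_sumr -big_split /=.
apply: eq_bigr => g _; rewrite scalerAl scalerAr -mulrDl -mulrDr.
congr (_ * _ * _); rewrite scaler_sumr -big_split /=; apply: eq_bigr => s _.
rewrite scaler_sumr -big_split /=; apply: eq_bigr => t _.
rewrite scalerA -scalerDl; congr (_ *: _).
have -> : orbval (a *: x + y) t = a * orbval x t + orbval y t.
  by rewrite [LHS]ffunE galg_scaleE.
by rewrite mulrDr mulrCA.
Qed.

Lemma creation_comp0 k : creation_comp m (0 : orbring k) = 0.
Proof.
have := creation_comp_is_linear (-1) (0 : orbring k) 0.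
by rewrite scaler0 addr0 scaleN1r addNr.
Qed.

Fact creation_finite y :
  exists N, forall n, (N <= n)%N -> creation_fun_comp y n = 0.
Proof.
have [N yN] := fock_finite y; exists (m + N)%N => n Nn.
rewrite /creation_fun_comp; case: eqP => // mn.
by rewrite yN ?creation_comp0 ?ecast_orbring0 //; lia.
Qed.

(* The operator p_{-m}, for m > 0. *)
Definition creation y : fock := Fock (creation_finite y).

Fact creation_is_linear : linear creation.
Proof.
move=> a x y; apply: fockP => n; rewrite fock_compD fock_compZ /=.
rewrite /creation_fun_comp; case: eqP => [mn|_]; last by rewrite scaler0 addr0.
by rewrite fock_compD fock_compZ creation_comp_is_linear ecast_orbring_linear.
Qed.

HB.instance Definition _ :=
  GRing.isLinear.Build rat fock fock _ creation creation_is_linear.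

Lemma creation_fock_inj k (x : orbring k) :
  creation (fock_inj x) = fock_inj (creation_comp m x).
Proof.
apply: fockP => n /=; rewrite /creation_fun_comp /fock_inj_comp.
case: (m + k =P n)%N => [mkn|mkNn]; last first.
  case: (m + (n - m) =P n)%N => // mn; rewrite /= /fock_inj_comp; case: (k =P n - m)%N => [kn|_].
    by case: mkNn; rewrite kn.
  by rewrite creation_comp0 ecast_orbring0.
case: _ / mkn; case: (m + (m + k - m) =P m + k)%N => [mn|[]]; last by rewrite addKn.
rewrite /= /fock_inj_comp; case: (k =P m + k - m)%N => [kn|[]]; last by rewrite addKn.
move: kn mn; rewrite addKn => kn mn.
by rewrite (eq_irrelevance kn erefl) (eq_irrelevance mn erefl).
Qed.
End Creation.

(* unit_creation k is the operator 1_{-k}. *)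
Definition unit_creation (k : int) (y : fock) : fock :=
  match k with
  | Posz j => j`!%:R^-1 *: iter j (creation 1) y
  | Negz _ => 0
  end.

(* The indices of one term of the linear combination: a set partition pi and, for
   each block B of pi, the integers m_B, r_B and n_{B,1} <= n_{B,2} <= ...  The
   values at sets B that are not blocks play no role. *)
Record term_index (s : nat) := TermIndex {
  blocks : {set {set 'I_s}};
  block_m : {set 'I_s} -> nat;
  block_r : {set 'I_s} -> nat;
  block_parts : {set 'I_s} -> seq nat }.

(* The last equation is over the integers, since m_B - 2 may be negative. *)
Definition admissible (s : nat) (k : 'I_s -> nat) (d : term_index s) : Prop :=
  [/\ partition (blocks d) [set: 'I_s],
      forall B, B \in blocks d ->
        [/\ (2 * block_r d B <= block_m d B <= 2 + \sum_(j in B) k j)%N,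
            size (block_parts d B) = (block_m d B - 2 * block_r d B)%N,
            all (fun m => 0 < m)%N (block_parts d B),
            sorted leq (block_parts d B)
          & (\sum_(m <- block_parts d B) m <= \sum_(j in B) (k j + 1))%N]
    & \sum_(B in blocks d)
         ((block_m d B)%:Z - 2 + (\sum_(m <- block_parts d B) m)%N%:Z) =
      (\sum_(j < s) k j)%N%:Z].

Definition fock_term (s n : nat) (d : term_index s) : fock :=
  unit_creation
    (n%:Z - (\sum_(B in blocks d) \sum_(m <- block_parts d B) m)%N%:Z)
    ((\big[comp/id]_(B in blocks d)
        \big[comp/id]_(m <- block_parts d B) (creation m : fock -> fock)) vacuum).

(* Main.v *)
From HB Require Import structures.
Require Import Defs.
From mathcomp Require Import all_boot all_order all_algebra all_fingroup.
From mathcomp Require Import zify ring boolp.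

Set Implicit Arguments.
Unset Strict Implicit.
Unset Printing Implicit Defensive.

Import GRing.Theory.
Local Open Scope ring_scope.

(** Expand every power of a Jucys-Murphy element into words of transpositions
    and remember, besides the product g of the transpositions of a word, the set
    A of all the points that occur in it.

    Shape of the terms.  Read a word from left to right and keep the factors
    O^(k_j) met so far in blocks, two factors being in one block when they are
    linked through common points.  The permutation is then a product of disjoint
    cycles, those of a block covering exactly the points of its factors.  If p,
    l and K are the numbers of points, of cycles and of transpositions of a
    block, then p + l + 2 g = K + 2 for some g >= 0: this is the Riemann-Hurwitz
    formula for a transitive product of transpositions, and it is proved one
    transposition at a time.  A transposition of the block splits a cycle (l
    grows by 1), joins two cycles of the block (l decreases by 1, g grows by 1),
    joins cycles of two blocks, which become one block, or absorbs a fresh point.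
    With m = l + 2 g this is the condition on m_i, r_i and n_{i,j}, the n_{i,j}
    being the lengths of the cycles; see [open_configuration_step],
    [spanned_power_sums] and [configuration_termP].

    Independence of n.  The construction makes sense when all the points are
    taken in a subset S of the n points, and Moebius inversion over S shows that
    the contribution c_A of the words with support exactly A is determined by the
    products over the subsets S.  An increasing injection respects the
    Jucys-Murphy elements, so it carries c_A to c_f(A) ([expansion_embed]), and
    every c_A is the image of the one element C_d = c_[d] of Q[S_d], d = #|A|.
    The product of the O^(k_j)(n) is invariant under conjugation, so it is its
    own average over S_n; averaging the sum of the c_A leaves, for each d, one
    n-independent combination of the averages of the permutations g of C_d,
    extended to n points by n - d fixed points.

    Fock space.  Permutations of the same cycle type are conjugate, so applying
    creation operators of indices n_1, n_2, ... to the vacuum gives, up to a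
    nonzero scalar, the trace over S_n of any permutation with cycles of these
    lengths ([create_vacuum]).  The n - d fixed points are n - d operators of
    index 1, which is what the factor 1_{-(n-d)} stands for
    ([unit_creation_create]). *)

(** * Permutations given by lists of disjoint cycles *)

Section Cycles.
Variable T : finType.
Implicit Types (s : {perm T}) (css : seq (seq T)) (c : seq T).

(** The cycles need not include all the fixed points of s, so that the points
    they cover can be any support containing the moved ones. *)
Definition disjoint_cycles s css :=
  [/\ uniq (flatten css), [::] \notin css, all (fcycle s) css
    & forall x, x \notin flatten css -> s x = x].

Lemma fpath_mul_tperm s (i l x : T) u : i \notin u -> l \notin u ->
  fpath (s * tperm i l)%g x u = fpath s x u.
Proof.
elim: u x => //= y u IHu x; rewrite !inE !negb_or => /andP[iy iu] /andP[ly lu].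
by rewrite IHu // permM (canF_eq (tpermK i l)) tpermD.
Qed.

(** Multiplying by the transposition of i and l exchanges these two images, hence
    exchanges the arrows that enter i and l. *)
Lemma fcycle_mul_tperm s (i l : T) u v : uniq (i :: u ++ l :: v) ->
  fcycle s (i :: u ++ l :: v) =
  fcycle (s * tperm i l)%g (i :: u) && fcycle (s * tperm i l)%g (l :: v).
Proof.
rewrite cons_uniq cat_uniq mem_cat negb_or inE negb_or /= -!andbA.
case/and5P=> iu il iv uu /andP[] /norP[lu _] /andP[lv vv].
rewrite rcons_cat cat_path /= !rcons_path !fpath_mul_tperm //= !permM.
rewrite !(canF_eq (tpermK i l)) tpermL tpermR.
by rewrite -!andbA; do !bool_congr.
Qed.

(** Splitting and joining cycles are the two directions of this equivalence, as
    multiplying by the transposition is an involution. *)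
Lemma disjoint_cycles_mul_tperm s i l u v css :
  disjoint_cycles s ((i :: u ++ l :: v) :: css) <->
  disjoint_cycles (s * tperm i l)%g ((i :: u) :: (l :: v) :: css).
Proof.
have E : flatten [:: i :: u, l :: v & css] = flatten ((i :: u ++ l :: v) :: css).
  by rewrite /= -catA.
rewrite /disjoint_cycles E.
have [U|NU] := boolP (uniq (flatten ((i :: u ++ l :: v) :: css))); last first.
  by split=> -[].
have fixE x : x \notin flatten ((i :: u ++ l :: v) :: css) ->
    (s * tperm i l)%g x = x <-> s x = x.
  move=> xN; rewrite permM (rwP eqP) (canF_eq (tpermK i l)) tpermD ?(rwP eqP) //.
    by apply: contraNneq xN => <-; rewrite inE eqxx.
  by apply: contraNneq xN => <-; rewrite /= !(inE, mem_cat) eqxx !orbT.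
have fcycleE : all (fcycle s) ((i :: u ++ l :: v) :: css) =
    all (fcycle (s * tperm i l)%g) [:: i :: u, l :: v & css].
  move: U; rewrite [flatten _]/= -cat_cons cat_uniq => /and3P[U D _].
  rewrite /= [RHS]andbA -[X in X && _]/(fcycle s (i :: u ++ l :: v)).
  rewrite fcycle_mul_tperm //; congr (_ && _); apply: eq_in_all => -[|a c] //= cin.
  have notin x : x \in i :: u ++ l :: v -> x \notin rcons c a.
    move=> xin; apply: contra D => xc; apply/hasP; exists x => //.
    by apply/flattenP; exists (a :: c) => //; rewrite -mem_rcons.
  by rewrite fpath_mul_tperm ?notin ?(inE, mem_cat, eqxx, orbT).
rewrite fcycleE !inE.
by split=> -[_ N F O]; split=> // x xN; apply/fixE => //; apply: O.
Qed.

Lemma disjoint_cycles_perm s css css' : perm_eq css css' ->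
  disjoint_cycles s css -> disjoint_cycles s css'.
Proof.
move=> P [U N F O]; have Pf := perm_flatten P.
split=> [|||x]; rewrite -?(perm_uniq Pf) -?(perm_mem P) -?(perm_all _ P) //.
by rewrite -(perm_mem Pf); apply: O.
Qed.

Lemma disjoint_cycles_rot s k c css :
  disjoint_cycles s (c :: css) -> disjoint_cycles s (rot k c :: css).
Proof.
have Pf : perm_eq (flatten (c :: css)) (flatten (rot k c :: css)).
  by rewrite /= perm_cat2r perm_sym perm_rot.
case=> U N F O; split=> [||| x].
- by rewrite -(perm_uniq Pf).
- by move: N; rewrite !inE !(eq_sym [::]) -!size_eq0 size_rot.
- by move: F; rewrite /= rot_cycle.
by rewrite -(perm_mem Pf); apply: O.
Qed.

Lemma disjoint_cycles_fixed s x css : x \notin flatten css ->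
  disjoint_cycles s css -> disjoint_cycles s ([:: x] :: css).
Proof.
move=> xN [U N F O]; split=> //=; first by rewrite xN.
  by rewrite O // eqxx.
by move=> y; rewrite inE negb_or => /andP[_ /O].
Qed.

(** Brings a point to the front of the first cycle, the form in which
    [disjoint_cycles_mul_tperm] applies. *)
Lemma disjoint_cycles_expose x css : x \in flatten css ->
  exists u css0, [/\ size css = (size css0).+1,
    perm_eq (flatten css) (flatten ((x :: u) :: css0))
    & forall s rest, disjoint_cycles s (css ++ rest) ->
        disjoint_cycles s ((x :: u) :: css0 ++ rest)].
Proof.
case/flattenP=> c cin xc; have P := perm_to_rem cin.
case: (rot_to xc) => k u E; exists u, (rem c css); split.
- by rewrite (perm_size P).
- apply: (perm_trans (perm_flatten P)).
  by rewrite /= -cat_cons -E perm_cat2r perm_sym perm_rot.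
move=> s rest H; rewrite -E; apply: disjoint_cycles_rot.
by apply: disjoint_cycles_perm H; rewrite -cat_cons perm_cat2r.
Qed.

(** The conjugating permutation sends the points of css, read in order, to those
    of css'. *)
Lemma same_shape_conj s s' css css' :
  disjoint_cycles s css -> disjoint_cycles s' css' ->
  (forall x, x \in flatten css) -> shape css = shape css' ->
  exists g : {perm T}, s' = (s ^ g)%g.
Proof.
move=> [U N F _] [U' N' F' _] full sh.
set L := flatten css in U full; set L' := flatten css' in U'.
have sz : size L = size L' by rewrite !size_flatten sh.
pose f x := nth x L' (index x L).
have fE x0 x : f x = nth x0 L' (index x L).
  by apply: set_nth_default; rewrite -sz index_mem full.
have injf : injective f.
  move=> x y; rewrite (fE x x) (fE x y) => /eqP.
  rewrite nth_uniq -?sz ?index_mem ?full // => /eqP.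
  by move/(congr1 (nth x L)); rewrite !nth_index ?full.
pose g := perm injf.
have mapg : map g L = L'.
  case EL: L => [|x0 L0]; first by apply/esym/size0nil; rewrite -sz EL.
  apply: (@eq_from_nth _ x0); rewrite ?size_map -EL // => i il.
  by rewrite (nth_map x0) // permE (fE x0) index_uniq.
have E : css' = map (map g) css.
  by rewrite -[css']flattenK -sh -/L' -mapg -map_reshape flattenK.
exists g; apply/permP=> y; rewrite -[y](permKV g); set x := (g^-1 y)%g.
rewrite permJ; have /flattenP[c cin xc] := full x.
have gc : map g c \in css' by rewrite E; apply: map_f.
have nextE (t : {perm T}) d z : fcycle t d -> z \in d -> t z = next d z.
  by move=> cd zd; have /eqP := next_cycle cd zd.
rewrite (nextE _ _ _ (allP F' _ gc)) ?map_f // (nextE _ _ _ (allP F _ cin)) //.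
apply: next_map; first exact: perm_inj.
by move: U; rewrite -/L (perm_uniq (perm_flatten (perm_to_rem cin))) cat_uniq => /andP[].
Qed.
End Cycles.

(** * Configurations: factors grouped in blocks of cycles *)

Ltac bool_cases := repeat match goal with
  | |- context [?a == ?b] => case: (a == b)
  | |- context [?x \in ?A] => case: (x \in A) end.

Section Configurations.
Variables (I : eqType) (T : finType) (k : I -> nat).
Implicit Types (r B : seq I) (A : {set T}) (s : {perm T}).
Implicit Types (css : seq (seq T)) (bs : seq (seq I * seq (seq T))).

(** For a block of b factors with K transpositions in all: g is the genus in the
    Riemann-Hurwitz formula, and each factor contributes at most one point plus
    one per transposition. *)
Definition balanced (K b : nat) css :=
  (exists g, size (flatten css) + size css + 2 * g = K + 2)%N /\
  (size (flatten css) <= K + b)%N.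

Definition balanced_block (b : seq I * seq (seq T)) :=
  balanced (\sum_(j <- b.1) k j) (size b.1) b.2.

(** Each element of bs is a block: the factors in it and the cycles of s that it
    covers.  The factors met so far are r, and the points met so far are A. *)
Definition configuration r A s bs :=
  [/\ perm_eq (flatten (unzip1 bs)) r, [::] \notin unzip1 bs,
      disjoint_cycles s (flatten (unzip2 bs)),
      A =i flatten (flatten (unzip2 bs))
    & forall b, b \in bs -> balanced_block b].

(** The state in the middle of a factor: m transpositions (l i) of the current
    factor, which is not yet in r, have been multiplied in.  The block of the
    current factor, with other factors B, is kept apart, and its first cycle
    starts at i. *)
Definition open_configuration r (m : nat) (i : T) A s B u css bs :=
  [/\ perm_eq (B ++ flatten (unzip1 bs)) r /\ [::] \notin unzip1 bs,
      disjoint_cycles s ((i :: u) :: css ++ flatten (unzip2 bs)),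
      A =i (i :: u) ++ flatten css ++ flatten (flatten (unzip2 bs)),
      balanced (\sum_(j <- B) k j + m) (size B).+1 ((i :: u) :: css)
    & forall b, b \in bs -> balanced_block b].

Lemma block_expose x bs : x \in flatten (flatten (unzip2 bs)) ->
  exists2 b, x \in flatten b.2 & exists bs0, perm_eq bs (b :: bs0).
Proof.
case/flattenP=> c /flatten_mapP[b bin cb] xc; exists b.
  by apply/flattenP; exists c.
by exists (rem b bs); apply: perm_to_rem.
Qed.

Lemma configuration_start r A s bs i :
  configuration r A s bs ->
  exists B u css bs', open_configuration r 0 i (i |: A) s B u css bs'.
Proof.
case=> Pr N D EA bal; have [iA|iNA] := boolP (i \in A); last first.
  exists [::], [::], [::], bs; split=> //=.
  - by apply: disjoint_cycles_fixed; rewrite -?EA.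
  - by move=> x; rewrite !inE EA.
  by rewrite big_nil; split=> //; exists 0%N.
move: iA; rewrite EA => /block_expose[[B cB] /= icB [bs0 P]].
have [u [css [sz Pf Dc]]] := disjoint_cycles_expose icB.
exists B, u, css, bs0.
have P1 := perm_map fst P; have P2 := perm_flatten (perm_map snd P).
split.
- split; first by apply: perm_trans Pr; rewrite perm_sym (perm_flatten P1).
  by move: N; rewrite (perm_mem P1) inE negb_or => /andP[].
- by apply/Dc/(disjoint_cycles_perm P2).
- move=> x; rewrite inE EA (perm_mem (perm_flatten P2)) /= flatten_cat !mem_cat.
  by rewrite (perm_mem Pf) !(inE, mem_cat); bool_cases.
- have := bal (B, cB); rewrite (perm_mem P) mem_head => /(_ isT)[[g /= E] /= le].
  move: E le; rewrite /balanced (perm_size Pf) sz => E le.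
  by rewrite addn0; split; [exists g | rewrite addnS leqW].
by move=> b bin; apply: bal; rewrite (perm_mem P) inE bin orbT.
Qed.

(** The four cases are: l is a fresh point, l is in the cycle of i, l is in
    another cycle of the block of i, l is in another block. *)
Lemma open_configuration_step r m i l A s B u css bs : l != i ->
  open_configuration r m i A s B u css bs ->
  exists B' u' css' bs',
    open_configuration r m.+1 i (l |: A) (s * tperm i l)%g B' u' css' bs'.
Proof.
move=> lNi [[Pr N] D EA [[g E] le] bal].
have [lA|lNA] := boolP (l \in A); last first.
  (* A fresh point is a cycle of length 1 that is joined to that of i. *)
  exists B, (u ++ [:: l]), css, bs; split=> //.
  - apply/disjoint_cycles_mul_tperm; rewrite -mulgA tperm2 mulg1.
    apply: (@disjoint_cycles_perm _ _ ([:: l] :: (i :: u) :: css ++ flatten (unzip2 bs))).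
      by rewrite (perm_catCA [:: [:: l]] [:: i :: u]).
    by apply: disjoint_cycles_fixed => //; rewrite -[_ \in _]/(l \in _) /= flatten_cat -EA.
  - by move=> x; rewrite in_setU1 EA !(inE, mem_cat); bool_cases.
  by split; [exists g; move: E | move: le]; rewrite /= !(size_cat, flatten_cat) /=; lia.
move: (lA); rewrite EA !mem_cat inE (negPf lNi) /= => /or3P[lu|lc|lb].
- case/splitPr: lu D EA E le => u1 u2 D EA E le.
  (* The cycle splits in two, which uses the added transposition. *)
  exists B, u1, ((l :: u2) :: css), bs; split=> //.
  + by apply/disjoint_cycles_mul_tperm.
  + by move=> x; rewrite in_setU1 EA !(inE, mem_cat); bool_cases.
  by split; [exists g; move: E | move: le]; rewrite /= !(size_cat, flatten_cat) /= ?size_cat /=; lia.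
- have [v [css0 [sz Pf Dc]]] := disjoint_cycles_expose lc.
  (* Two cycles of one block are joined: the genus g grows by 1. *)
  exists B, (u ++ l :: v), css0, bs; split=> //.
  + apply/disjoint_cycles_mul_tperm; rewrite -mulgA tperm2 mulg1.
    apply: (@disjoint_cycles_perm _ _ ([:: l :: v, i :: u & css0 ++ flatten (unzip2 bs)])).
      by rewrite (perm_catCA [:: l :: v] [:: i :: u]).
    have := Dc s ((i :: u) :: flatten (unzip2 bs)).
    set X := disjoint_cycles s (_ :: _ ++ _).
    have -> : X = disjoint_cycles s ((l :: v) :: css0 ++ (i :: u) :: flatten (unzip2 bs)) by [].
    move=> H; apply: (disjoint_cycles_perm _ (H _)); last first.
      by apply: disjoint_cycles_perm D; rewrite perm_sym (perm_catCA css [:: i :: u]).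
    by rewrite /= perm_cons (perm_catCA css0 [:: i :: u]).
  + move=> x; rewrite in_setU1 EA !mem_cat (perm_mem Pf) !(inE, mem_cat).
    by bool_cases.
  move: le E (perm_size Pf); rewrite /= !size_cat /= => le E Es.
  rewrite Es sz in le E.
  by split; [exists g.+1 | ]; rewrite /= !size_cat /=; lia.
have [[C cC] /= lC [bs0 P]] := block_expose lb.
have P1 := perm_map fst P; have P2 := perm_flatten (perm_map snd P).
have [v [css0 [sz Pf Dc]]] := disjoint_cycles_expose lC.
(* Two blocks are joined, and their genera are added. *)
exists (B ++ C), (u ++ l :: v), (css ++ css0), bs0; split.
- split; first by rewrite -catA; apply: perm_trans Pr; rewrite perm_cat2l perm_sym (perm_flatten P1).
  by move: N; rewrite (perm_mem P1) inE negb_or => /andP[].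
- apply/disjoint_cycles_mul_tperm; rewrite -mulgA tperm2 mulg1.
  pose R := flatten (unzip2 bs0).
  have := Dc s ((i :: u) :: css ++ R).
  have : disjoint_cycles s (cC ++ (i :: u) :: css ++ R).
    apply: disjoint_cycles_perm D; apply/seq.permP=> p.
    have /seq.permP/(_ p) := P2; rewrite /= !count_cat /= !count_cat => ->.
    by rewrite (addnCA (count p css)) (addnCA (p _)).
  move=> H /(_ H) {}H; apply: (disjoint_cycles_perm _ H).
  by apply/seq.permP=> p; rewrite /R /= !count_cat /= !count_cat; lia.
- move=> x; rewrite in_setU1 EA !mem_cat (perm_mem (perm_flatten P2)) /= !flatten_cat.
  rewrite !(inE, mem_cat) (perm_mem Pf) !(inE, mem_cat).
  by bool_cases.
- have := bal (C, cC); rewrite (perm_mem P) mem_head => /(_ isT)[[g' /= E'] /= le'].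
  move: le E (perm_size Pf) E' le'; rewrite /= !size_cat /= => le E Es E' le'.
  rewrite Es sz in le' E'.
  by split; [exists (g + g')%N|]; rewrite big_cat /= flatten_cat !size_cat /=; lia.
by move=> b bin; apply: bal; rewrite (perm_mem P) inE bin orbT.
Qed.

Lemma open_configuration_close r j i A s B u css bs :
  open_configuration r (k j) i A s B u css bs ->
  configuration (rcons r j) A s ((j :: B, (i :: u) :: css) :: bs).
Proof.
case=> -[Pr N] D EA [[g E] le] bal; split=> //.
- by rewrite /= perm_sym perm_rcons perm_cons perm_sym.
- by move=> x; rewrite EA /= flatten_cat !(inE, mem_cat); bool_cases.
move=> b; rewrite inE => /predU1P[->|]; last exact: bal.
by split; [exists g|]; rewrite /= big_cons; move: E le => /=; lia.
Qed.
End Configurations.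

(** * The index of a configuration *)

Lemma uniq_flatten_mem (I : eqType) (L : seq (seq I)) (c c' : seq I) j :
  uniq (flatten L) -> c \in L -> c' \in L -> j \in c -> j \in c' -> c = c'.
Proof.
elim: L => // d L IHL; rewrite /= cat_uniq => /and3P[_ D U].
have disj e : e \in L -> j \in d -> j \in e -> False.
  by move=> eL jd je; case/hasP: D; exists j => //; apply/flattenP; exists e.
rewrite !inE => /predU1P[->|cL] /predU1P[->|c'L] // jc jc'; last exact: IHL.
- by case: (disj c').
- by case: (disj c).
Qed.

Lemma filter_fiber_uniq (S S' : eqType) (f : S -> S') (l : seq S) x :
  uniq (map f l) -> x \in l -> [seq y <- l | f y == f x] = [:: x].
Proof.
elim: l => //= y l IHl /andP[yN U]; rewrite inE => /predU1P[->|xl].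
  rewrite eqxx (eq_in_filter (a2 := pred0)) ?filter_pred0 // => z zl /=.
  by apply: contraNF yN => /eqP E; rewrite -E map_f.
rewrite IHl //; case: eqP => // E.
by rewrite E map_f in yN.
Qed.

(** In the order of the creation operators in [fock_term]. *)
Definition term_parts s (d : term_index s) : seq nat :=
  flatten [seq block_parts d B | B <- index_enum {set 'I_s} & B \in blocks d].

Section TermOfConfiguration.
Variables (s : nat) (k : 'I_s -> nat) (T : finType).
Implicit Types (bs : seq (seq 'I_s * seq (seq T))).

Let supp (b : seq 'I_s * seq (seq T)) : {set 'I_s} := [set j in b.1].

Definition cycles_at bs (B : {set 'I_s}) : seq (seq T) :=
  flatten [seq b.2 | b <- bs & supp b == B].

(** As m = l + 2 g and p + l + 2 g = K + 2, the value of m is K + 2 - p. *)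
Definition configuration_term bs : term_index s :=
  let K (B : {set _}) := (\sum_(j in B) k j)%N in
  let m B := (K B + 2 - size (flatten (cycles_at bs B)))%N in
  TermIndex [set B in map supp bs] m
    (fun B => (m B - size (cycles_at bs B))./2)
    (fun B => sort leq (shape (cycles_at bs B))).

Lemma configuration_termP (A : {set T}) (g : {perm T}) bs :
  configuration k (index_enum 'I_s) A g bs ->
  admissible k (configuration_term bs) /\
  perm_eq (term_parts (configuration_term bs)) (shape (flatten (unzip2 bs))).
Proof.
case=> Pr N [Uc Nc _ _] _ bal.
have Uf : uniq (flatten (unzip1 bs)) by rewrite (perm_uniq Pr) index_enum_uniq.
have Uset : uniq (map supp bs).
  elim: bs Uf N {Pr Uc Nc bal} => //= b bs IHbs; rewrite cat_uniq inE negb_or.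
  case/and3P=> _ D U /andP[bN N]; rewrite IHbs // andbT; apply/mapP=> -[b' b'in E].
  case Eb: b.1 bN => [|j c] // _; case/hasP: D; exists j; last by rewrite Eb mem_head.
  apply/flatten_mapP; exists b' => //.
  have : j \in supp b by rewrite inE Eb mem_head.
  by rewrite E inE.
have cycE b : b \in bs -> cycles_at bs (supp b) = b.2.
  by move=> bin; rewrite /cycles_at filter_fiber_uniq //= cats0.
have Ub b : b \in bs -> uniq b.1.
  move=> bin; have := Uf.
  rewrite (perm_uniq (perm_flatten (perm_to_rem (map_f fst bin)))) /= cat_uniq.
  by case/andP.
have sumE b (F : 'I_s -> nat) : b \in bs ->
    (\sum_(j in supp b) F j = \sum_(j <- b.1) F j)%N.
  by move=> bin; rewrite (big_uniq _ (Ub _ bin)) /=; apply: eq_bigl => j; rewrite inE.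
have Nempty b : b \in bs -> [::] \notin b.2.
  move=> bin; apply: contra Nc => E0; apply/flattenP; exists b.2 => //.
  exact: map_f.
have mE b : b \in bs -> exists g,
    (\sum_(j <- b.1) k j + 2 - size (flatten b.2) = size b.2 + 2 * g)%N.
  by move=> /bal[[g' E] _]; exists g'; rewrite -E -addnA addKn.
split; last first.
  rewrite /term_parts /configuration_term /=.
  have P : perm_eq [seq B <- index_enum _ | B \in [set B in map supp bs]] (map supp bs).
    apply: uniq_perm; rewrite ?filter_uniq ?index_enum_uniq // => B.
    by rewrite mem_filter inE mem_index_enum andbT.
  apply: (perm_trans (perm_flatten (perm_map _ P))); rewrite -map_comp.
  suff H l : {subset l <= bs} ->
    perm_eq (flatten [seq sort leq (shape (cycles_at bs (supp b))) | b <- l])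
            (shape (flatten (unzip2 l))) by exact: H.
  elim: l => // b l IHl sub /=; rewrite /shape map_cat perm_cat ?IHl //.
    by rewrite perm_sort cycE // sub ?mem_head.
  by move=> b' b'l; apply: sub; rewrite inE b'l orbT.
split=> /=.
- apply/and3P; split.
  + apply/eqP/setP=> j; rewrite inE; apply/bigcupP.
    have : j \in flatten (unzip1 bs) by rewrite (perm_mem Pr) mem_index_enum.
    by case/flatten_mapP=> b bin jb; exists (supp b); rewrite !inE ?map_f.
  + apply/trivIsetP=> B B' /[!inE] /mapP[b bin ->] /mapP[b' b'in ->] NE.
    rewrite -setI_eq0; apply: contraNT NE => /set0Pn[j]; rewrite !inE => /andP[jb jb'].
    by rewrite /supp (uniq_flatten_mem Uf (map_f _ bin) (map_f _ b'in) jb jb').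
  rewrite inE; apply/mapP=> -[b bin /setP E].
  case Eb: b.1 => [|j c]; last by have := E j; rewrite !inE Eb mem_head.
  by case/negP: N; rewrite -Eb map_f.
- move=> B /[!inE] /mapP[b bin ->]; have [g' E'] := mE b bin.
  have [_ le] := bal b bin.
  have halfE : ((size b.2 + 2 * g' - size b.2)./2 = g')%N.
    by rewrite addKn mul2n doubleK.
  rewrite cycE // !sumE // E' size_sort size_map; split.
  + by rewrite halfE leq_addl /= -E' addnC leq_subr.
  + by rewrite halfE addnK.
  + rewrite all_sort all_map; apply/allP=> c cin /=; rewrite lt0n size_eq0.
    by apply: contraNneq (Nempty b bin) => <-.
  + by apply: sort_sorted; apply: leq_total.
  rewrite (perm_big _ (permEl (perm_sort _ _))) /= -sumnE -size_flatten big_split /=.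
  by rewrite sum1_size.
rewrite (eq_bigl (fun B => B \in map supp bs)) => [|B]; last by rewrite inE.
rewrite -big_uniq //= big_map.
rewrite (eq_big_seq (fun b => (\sum_(j <- b.1) k j)%N%:Z)) => [|b bin].
  rewrite -(big_morph Posz PoszD (erefl 0%:Z)); congr Posz.
  by rewrite -(perm_big _ Pr) big_flatten big_map.
have [[g' E] _] := bal b bin.
rewrite cycE // sumE // (perm_big _ (permEl (perm_sort _ _))) /= -sumnE -size_flatten.
by rewrite -subzn ?PoszD 1?addrAC ?subrK ?addrK // -E -addnA leq_addr.
Qed.
End TermOfConfiguration.

(** * Expansions over supports *)

(** The relation between the sum P S of the words in S and the sum c A of the
    words with support exactly A. *)
Definition expands_into (T : finType) (V : zmodType) (c P : {set T} -> V) :=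
  forall S, P S = \sum_(A : {set T} | A \subset S) c A.

(** Moebius inversion, in the form of an induction on #|A|. *)
Lemma expands_into_inj (T : finType) (V : zmodType) (c c' P : {set T} -> V) :
  expands_into c P -> expands_into c' P -> c =1 c'.
Proof.
move=> cP cP' A; have [m] := ubnP #|A|; elim: m A => // m IH A /ltnSE Am.
have := cP A; rewrite (cP' A) (bigD1 A) //= [RHS](bigD1 A) //=.
rewrite (eq_bigr c) => [/addIr ->//|B /andP[BA BNA]].
by rewrite (IH B) // (leq_trans _ Am) // proper_card // properEneq BNA.
Qed.

Section SupportedExpansion.
Variable n : nat.
Local Notation e := (@galg_of rat 'S_n).
Implicit Types (P : {set 'I_n} -> galg rat 'S_n).
Implicit Types (Q : {set 'I_n} -> 'S_n -> Prop).

Definition supported Q (c : {set 'I_n} -> galg rat 'S_n) :=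
  forall A g, c A g != 0 -> Q A g.

(** Stability of this predicate under sums and under multiplication by a
    transposition replaces the explicit handling of words: Q says which pairs
    (support, product) can occur. *)
Definition spanned Q P := exists2 c, expands_into c P & supported Q c.

Lemma galg_mul_of (x : galg rat 'S_n) (t g : 'S_n) : (x * e t) g = x (g * t^-1)%g.
Proof.
rewrite galg_mulE (bigD1 (g * t^-1)%g) //= big1 => [|h hN].
  by rewrite ffunE invMg invgK mulgKV eqxx mulr1 addr0.
rewrite ffunE; have [E|_] := eqVneq (h^-1 * g)%g t; last by rewrite mulr0.
by move: hN; rewrite -E invMg invgK mulKVg eqxx.
Qed.

Lemma eq_spanned Q P P' : (forall S, P S = P' S) -> spanned Q P -> spanned Q P'.
Proof. by move=> E [c cP cQ]; exists c => // S; rewrite -E. Qed.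

Lemma spanned_imply Q Q' P : (forall A g, Q A g -> Q' A g) ->
  spanned Q P -> spanned Q' P.
Proof. by move=> QQ [c cP cQ]; exists c => // A g /cQ/QQ. Qed.

Lemma spanned0 Q : spanned Q (fun=> 0).
Proof.
exists (fun=> 0) => [S|A g]; first by rewrite big1.
by rewrite ffunE eqxx.
Qed.

Lemma spannedD Q P P' : spanned Q P -> spanned Q P' ->
  spanned Q (fun S => P S + P' S).
Proof.
move=> [c cP cQ] [c' cP' cQ']; exists (fun A => c A + c' A) => [S|A g].
  by rewrite cP cP' big_split.
rewrite ffunE; have [->|/cQ //] := eqVneq (c A g) 0.
by rewrite add0r => /cQ'.
Qed.

Lemma spannedN Q P : spanned Q P -> spanned Q (fun S => - P S).
Proof.
move=> [c cP cQ]; exists (fun A => - c A) => [S|A g]; first by rewrite cP sumrN.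
by rewrite ffunE oppr_eq0 => /cQ.
Qed.

Lemma spanned_sum Q (J : finType) (p : pred J) (P : J -> {set 'I_n} -> galg rat 'S_n) :
  (forall j, p j -> spanned Q (P j)) -> spanned Q (fun S => \sum_(j | p j) P j S).
Proof.
move=> H; elim: (index_enum J) => [|j r IHr].
  by apply: eq_spanned (spanned0 Q) => S; rewrite big_nil.
have [pj|pNj] := boolP (p j).
  by apply: eq_spanned (spannedD (H j pj) IHr) => S; rewrite big_cons pj.
by apply: eq_spanned IHr => S; rewrite big_cons (negPf pNj).
Qed.

(** One more letter of the words: the point l is added to the supports. *)
Lemma spanned_mul Q Q' P (l : 'I_n) (t : 'S_n) :
  (forall A g, Q A g -> Q' (l |: A) (g * t)%g) -> spanned Q P ->
  spanned Q' (fun S => if l \in S then P S * e t else 0).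
Proof.
move=> QQ [c cP cQ].
exists (fun D => \sum_(A | l |: A == D) c A * e t) => [S|D g].
  transitivity (\sum_(A | l |: A \subset S) c A * e t).
    case: ifP => lS; last by rewrite big_pred0 // => A; rewrite subUset sub1set lS.
    rewrite cP mulr_suml; apply: eq_bigl => A.
    by rewrite subUset sub1set lS.
  rewrite (partition_big (fun A => l |: A) (fun D => D \subset S)) //=.
  apply: eq_bigr => D DS; apply: eq_bigl => A.
  by case: eqP => [->|]; rewrite ?DS ?andbF.
rewrite sum_ffunE.
have [A /andP[/eqP <- cA _]|c0] :=
  pickP (fun A => (l |: A == D) && (c A (g * t^-1)%g != 0)).
  by rewrite -[g](mulgKV t); apply/QQ/cQ.
rewrite big1 ?eqxx // => A lA; rewrite galg_mul_of.
by apply/eqP; move: (c0 A); rewrite lA /= => /negbFE.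
Qed.
End SupportedExpansion.

Section SubsetJucysMurphy.
Variables (n : nat) (J : eqType) (k : J -> nat).
Local Notation e := (@galg_of rat 'S_n).

(** The Jucys-Murphy element of the point i among the points of S. *)
Definition subset_jm (S : {set 'I_n}) (i : 'I_n) : galg rat 'S_n :=
  \sum_(l < n | (l < i)%N) if l \in S then e (tperm l i) else 0.

Definition subset_power_sums (r : seq J) (S : {set 'I_n}) : galg rat 'S_n :=
  \prod_(j <- r) \sum_(i in S) (- subset_jm S i) ^+ k j.

(** Expands factor after factor, and each factor transposition after
    transposition. *)
Lemma spanned_power_sums r : spanned
  (fun A g => exists bs, configuration k r A g bs) (subset_power_sums r).
Proof.
elim/last_ind: r => [|r j IHr].
  exists (fun A => if A == set0 then 1 else 0) => [S|A g].
    rewrite -big_mkcondr (big_pred1 set0) ?/subset_power_sums ?big_nil // => A.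
    by rewrite andbC /=; have [->|] := eqVneq A set0; rewrite ?sub0set.
  have [->|_] := eqVneq A set0; last by rewrite ffunE eqxx.
  rewrite ffunE; have [->|_] := eqVneq g 1%g; last by rewrite eqxx.
  move=> _.
  exists [::]; split=> // [|x]; last by rewrite inE.
  by split=> // x _; rewrite perm1.
(* The words whose last factor is at the point i and has m letters so far. *)
pose F i m (S : {set 'I_n}) := if i \in S then subset_power_sums r S * (- subset_jm S i) ^+ m else 0.
pose Q (i : 'I_n) m A g := exists B u css bs, open_configuration k r m i A g B u css bs.
have step i m : spanned (Q i m) (F i m).
  elim: m => [|m IHm].
    apply: eq_spanned (spanned_mul (l := i) (t := 1%g) _ IHr) => [S|A g [bs]].
      by rewrite /F galg_of1 expr0.
    by rewrite mulg1; apply: configuration_start.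
  apply: (@eq_spanned _ _ (fun S => - \sum_(l < n | (l < i)%N)
      if l \in S then F i m S * e (tperm i l) else 0)) => [S|].
    rewrite /F exprSr; case: ifP => iS; last first.
      by rewrite big1 ?oppr0 // => l _; rewrite mul0r if_same.
    rewrite mulrA mulrN mulr_sumr; congr (- _); apply: eq_bigr => l _.
    by rewrite tpermC; case: ifP; rewrite ?mulr0.
  apply: spannedN; apply: spanned_sum => l li; apply: spanned_mul IHm => A g.
  move=> [B [u [css [bs H]]]]; apply: open_configuration_step H.
  by rewrite neq_ltn li.
have := spanned_sum (fun i (_ : true) => spanned_imply _ (step i (k j))).
move=> /(_ (fun A g => exists bs, configuration k (rcons r j) A g bs)) H.
apply: eq_spanned (H _) => [S|i A g [B [u [css [bs /open_configuration_close]]]]].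
  rewrite /subset_power_sums -cats1 big_cat big_seq1 /= mulr_sumr [RHS]big_mkcond.
  by apply: eq_bigr.
by exists ((j :: B, (i :: u) :: css) :: bs).
Qed.
End SubsetJucysMurphy.

(** * Naturality under increasing injections *)

Section PermEmbedding.
Variables (T T' : finType) (f : T -> T').
Hypothesis injf : injective f.

Definition embed_fun (s : {perm T}) (x : T') : T' :=
  if [pick a | f a == x] is Some a then f (s a) else x.

Lemma embed_fun_in s a : embed_fun s (f a) = f (s a).
Proof.
rewrite /embed_fun; case: pickP => [b /eqP/injf -> //|/(_ a)].
by rewrite eqxx.
Qed.

Lemma embed_fun_out s x : x \notin codom f -> embed_fun s x = x.
Proof.
by rewrite /embed_fun; case: pickP => // a /eqP <-; rewrite codom_f.
Qed.

Fact embed_fun_can s : cancel (embed_fun s) (embed_fun s^-1).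
Proof.
move=> x; have [/codomP[a ->]|xN] := boolP (x \in codom f).
  by rewrite !embed_fun_in permK.
by rewrite !embed_fun_out.
Qed.

Definition embed_perm (s : {perm T}) : {perm T'} := perm (can_inj (embed_fun_can s)).

Lemma embed_perm_in s a : embed_perm s (f a) = f (s a).
Proof. by rewrite permE embed_fun_in. Qed.

Lemma embed_perm_out s x : x \notin codom f -> embed_perm s x = x.
Proof. by rewrite permE; apply: embed_fun_out. Qed.

Lemma embed_permM : {morph embed_perm : s t / (s * t)%g}.
Proof.
move=> s t; apply/permP=> x; rewrite permM.
have [/codomP[a ->]|xN] := boolP (x \in codom f).
  by rewrite !embed_perm_in permM.
by rewrite !embed_perm_out.
Qed.

Lemma embed_perm1 : embed_perm 1 = 1%g.
Proof. by apply: (mulgI (embed_perm 1)); rewrite -embed_permM !mulg1. Qed.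

Lemma embed_tperm a b : embed_perm (tperm a b) = tperm (f a) (f b).
Proof.
apply/permP=> x; have [/codomP[c ->]|xN] := boolP (x \in codom f).
  by rewrite embed_perm_in inj_tperm.
by rewrite embed_perm_out // tpermD //; apply: contraNneq xN => <-; apply: codom_f.
Qed.

Lemma disjoint_cycles_embed s css :
  disjoint_cycles s css -> disjoint_cycles (embed_perm s) (map (map f) css).
Proof.
case=> U N F O; split.
- by rewrite -map_flatten map_inj_uniq.
- by apply: contra N => /mapP[[|x c] //].
- rewrite all_map; apply: sub_all F => c /= Fc; rewrite cycle_map.
  by apply: sub_cycle Fc => x y /= /eqP <-; rewrite embed_perm_in.
move=> x; rewrite -map_flatten.
have [/codomP[a ->]|xN _] := boolP (x \in codom f); last exact: embed_perm_out.
by rewrite mem_map // embed_perm_in => /O ->.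
Qed.
End PermEmbedding.

Section AlgebraEmbedding.
Variables (d n : nat) (f : 'I_d -> 'I_n) (injf : injective f).

Definition embed_galg (x : galg rat 'S_d) : galg rat 'S_n :=
  \sum_g x g *: galg_of rat (embed_perm injf g).

Fact embed_galg_is_linear : linear embed_galg.
Proof.
move=> a x y; rewrite /embed_galg scaler_sumr -big_split; apply: eq_bigr => g _ /=.
by rewrite scalerA -scalerDl ffunE galg_scaleE.
Qed.

HB.instance Definition _ :=
  GRing.isLinear.Build rat (galg rat 'S_d) (galg rat 'S_n) _ embed_galg
    embed_galg_is_linear.

Lemma embed_galg_of g : embed_galg (galg_of rat g) = galg_of rat (embed_perm injf g).
Proof.
rewrite /embed_galg (bigD1 g) //= big1 => [|h hN].
  by rewrite ffunE eqxx scale1r addr0.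
by rewrite ffunE (negPf hN) scale0r.
Qed.

Fact embed_galg_is_monoid_morphism : monoid_morphism embed_galg.
Proof.
split; first by rewrite -galg_of1 embed_galg_of embed_perm1.
move=> x y; rewrite [x]galg_sum [y]galg_sum.
rewrite mulr_suml !linear_sum mulr_suml; apply: eq_bigr => g _ /=.
rewrite !mulr_sumr !linear_sum /=; apply: eq_bigr => h _.
rewrite -scalerAl -scalerAr !linearZ /= -galg_ofM !embed_galg_of embed_permM galg_ofM.
by rewrite -scalerAl -scalerAr.
Qed.

HB.instance Definition _ :=
  GRing.isMonoidMorphism.Build (galg rat 'S_d) (galg rat 'S_n) embed_galg
    embed_galg_is_monoid_morphism.

Hypothesis incrf : {mono f : i j / (i < j)%N}.

Lemma subset_jm_embed (S : {set 'I_d}) i :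
  subset_jm (f @: S) (f i) = embed_galg (subset_jm S i).
Proof.
have jmE m (A : {set 'I_m}) a : subset_jm A a =
    \sum_(l in A) if (l < a)%N then galg_of rat (tperm l a) else 0.
  by rewrite /subset_jm -!big_mkcondr; apply: eq_bigl => l; rewrite andbC.
rewrite !jmE big_imset => [|? ? _ _ /injf //] /=.
rewrite linear_sum /=; apply: eq_bigr => l _; rewrite incrf.
by case: ifP => _; rewrite ?linear0 // embed_galg_of embed_tperm.
Qed.

Lemma subset_power_sums_embed (J : eqType) (k : J -> nat) r (S : {set 'I_d}) :
  subset_power_sums k r (f @: S) = embed_galg (subset_power_sums k r S).
Proof.
rewrite /subset_power_sums rmorph_prod; apply: eq_bigr => j _.
rewrite big_imset => [|? ? _ _ /injf //] /=.
rewrite linear_sum /=; apply: eq_bigr => i _.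
by rewrite subset_jm_embed rmorphXn rmorphN.
Qed.

(** Both sides expand the same sums over the subsets of the image of f, so they
    agree by uniqueness. *)
Lemma expansion_embed (J : eqType) (k : J -> nat) r c c' :
  expands_into c (@subset_power_sums d J k r) ->
  expands_into c' (@subset_power_sums n J k r) ->
  forall A : {set 'I_d}, c' (f @: A) = embed_galg (c A).
Proof.
move=> cP cP'.
apply: (@expands_into_inj _ _ _ _ (fun S : {set 'I_d} => subset_power_sums k r (f @: S))) => S.
  rewrite cP' (reindex_onto (fun A : {set 'I_d} => f @: A) (fun B : {set 'I_n} => f @^-1: B)) /=.
    apply: eq_bigl => A; have fK : f @^-1: (f @: A) = A.
      by apply/setP=> x; rewrite inE mem_imset.
    rewrite fK eqxx andbT; apply/idP/idP => [/(preimsetS f)|]; last exact: imsetS.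
    rewrite fK => /subset_trans; apply; apply/subsetP=> x.
    by rewrite inE mem_imset.
  move=> B BS; apply/setP=> x; apply/imsetP/idP => [[a]|xB].
    by rewrite inE => aB ->.
  have /imsetP[a _ E] := subsetP BS x xB.
  by exists a; rewrite // inE -E.
by rewrite subset_power_sums_embed cP linear_sum.
Qed.
End AlgebraEmbedding.

(** * Traces over the symmetric group *)

Fact fock_inj_is_linear n : linear (@fock_inj n).
Proof.
move=> a x y; apply: fockP => m; rewrite fock_compD fock_compZ /= /fock_inj_comp.
by case: eqP => [nm|_]; rewrite ?ecast_orbring_linear // scaler0 addr0.
Qed.

HB.instance Definition _ n :=
  GRing.isLinear.Build rat (orbring n) fock _ (@fock_inj n) (@fock_inj_is_linear n).

Fact conj_trace_is_linear n : linear (@conj_trace n).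
Proof.
move=> a x y; apply: val_inj; rewrite /= scaler_sumr -big_split; apply: eq_bigr => g _ /=.
by rewrite mulrDr mulrDl -scalerAr -scalerAl.
Qed.

HB.instance Definition _ n :=
  GRing.isLinear.Build rat (galg rat 'S_n) (orbring n) _ (@conj_trace n)
    (@conj_trace_is_linear n).

Definition perm_trace n (g : 'S_n) : orbring n := conj_trace (galg_of rat g).

Lemma perm_traceE n (g : 'S_n) :
  orbval (perm_trace g) = \sum_(h : 'S_n) galg_of rat (g ^ h)%g.
Proof.
rewrite /perm_trace /= (reindex_inj invg_inj); apply: eq_bigr => h _.
by rewrite -!galg_ofM invgK conjgE mulgA.
Qed.

Lemma perm_traceJ n (g h : 'S_n) : perm_trace (g ^ h)%g = perm_trace g.
Proof.
apply: val_inj; rewrite -[LHS]/(orbval _) -[RHS]/(orbval _) !perm_traceE [RHS](reindex_inj (mulgI h)).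
by apply: eq_bigr => h' _; rewrite conjgM.
Qed.

Lemma conj_trace_invariant n (x : orbring n) : conj_trace x = n`!%:R *: x.
Proof.
apply: val_inj; rewrite /= (eq_bigr (fun=> orbval x)) => [|g _].
  by rewrite sumr_const card_Sn scaler_nat.
have /conj_invP -> := orbvalP x.
by rewrite -mulrA -galg_ofM mulgV mulr1.
Qed.

Section PermSumTheory.
Variables m k : nat.

Lemma perm_sum_lshift (s : 'S_m) (t : 'S_k) i :
  perm_sum s t (lshift k i) = lshift k (s i).
Proof. by rewrite permE /perm_sum_fun (unsplitK (inl i)). Qed.

Lemma perm_sum_rshift (s : 'S_m) (t : 'S_k) i :
  perm_sum s t (rshift m i) = rshift m (t i).
Proof. by rewrite permE /perm_sum_fun (unsplitK (inr i)). Qed.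

Lemma perm_sumM (s s' : 'S_m) (t t' : 'S_k) :
  perm_sum (s * s')%g (t * t')%g = (perm_sum s t * perm_sum s' t')%g.
Proof.
apply/permP=> i; rewrite permM -[i]splitK; case: (split i) => a /=.
  by rewrite !perm_sum_lshift permM.
by rewrite !perm_sum_rshift permM.
Qed.

Lemma perm_sumJ (s h : 'S_m) (t g : 'S_k) :
  perm_sum (s ^ h)%g (t ^ g)%g = (perm_sum s t ^ perm_sum h g)%g.
Proof.
by apply: (mulgI (perm_sum h g)); rewrite -conjgC -!perm_sumM -!conjgC.
Qed.

Lemma disjoint_cycles_perm_sum (s : 'S_m) (t : 'S_k) css css' :
  disjoint_cycles s css -> disjoint_cycles t css' ->
  disjoint_cycles (perm_sum s t)
    (map (map (lshift k)) css ++ map (map (@rshift m k)) css').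
Proof.
move=> [U N F O] [U' N' F' O']; split.
- rewrite flatten_cat -!map_flatten cat_uniq !map_inj_uniq ?U ?U' //.
  + rewrite andbT; apply/hasP=> -[_ /mapP[a _ ->] /mapP[b _ /eqP]].
    by rewrite eq_rlshift.
  + exact: rshift_inj.
  + exact: lshift_inj.
- rewrite mem_cat negb_or; apply/andP; split.
    by apply: contra N => /mapP[[|x c] //].
  by apply: contra N' => /mapP[[|x c] //].
- rewrite all_cat !all_map; apply/andP; split.
    apply: sub_all F => c /= Fc; rewrite cycle_map.
    by apply: sub_cycle Fc => x y /= /eqP <-; rewrite perm_sum_lshift.
  apply: sub_all F' => c /= Fc; rewrite cycle_map.
  by apply: sub_cycle Fc => x y /= /eqP <-; rewrite perm_sum_rshift.
move=> i; rewrite flatten_cat -!map_flatten mem_cat negb_or -[i]splitK.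
case: (split i) => a /= /andP[].
  rewrite mem_map => [aN _|]; last exact: lshift_inj.
  by rewrite perm_sum_lshift O.
rewrite perm_sum_rshift => _; rewrite mem_map => [aN|]; last exact: rshift_inj.
by rewrite O'.
Qed.

(** The k! conjugates of t that make up its trace all contribute equally, since
    conjugating t within S_k is conjugating [perm_sum s t]. *)
Lemma trace_galg_tensor (x : galg rat 'S_m) (t : 'S_k) :
  conj_trace (galg_tensor x (perm_trace t)) =
  \sum_s (k`!%:R * x s) *: perm_trace (perm_sum s t).
Proof.
rewrite perm_traceE /galg_tensor linear_sum; apply: eq_bigr => s _ /=.
rewrite linear_sum /= mulrC -scalerA scaler_nat -[in RHS]card_Sn -sumr_const.
transitivity (\sum_(t' : 'S_k) \sum_(h : 'S_k)
    (x s * (t' == (t ^ h)%g)%:R) *: perm_trace (perm_sum s t')).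
  apply: eq_bigr => t' _; rewrite linearZ /= sum_ffunE mulr_sumr scaler_suml.
  by apply: eq_bigr => h _; rewrite ffunE.
rewrite exchange_big scaler_sumr; apply: eq_big => [h|h _]; first by rewrite inE.
rewrite (bigD1 (t ^ h)%g) //= big1 => [|t' /negPf ->]; last by rewrite mulr0 scale0r.
rewrite eqxx mulr1 addr0 -[s in perm_sum s (t ^ h)%g]conjg1.
by rewrite perm_sumJ perm_traceJ.
Qed.
End PermSumTheory.

(** * Creation operators on cycle types *)

Lemma single_orbit_disjoint_cycles m (s : 'S_m) : (0 < m)%N ->
  #|porbits s| == 1%N -> exists2 c, disjoint_cycles s [:: c] &
    size c = m /\ forall x, x \in c.
Proof.
case: m s => // m s _ /cards1P[X EX].
have orb (x : 'I_m.+1) : porbit s x = X.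
  by apply/set1P; rewrite -EX; apply: imset_f.
have full x : x \in fingraph.orbit s ord0.
  have : x \in porbit s ord0 by rewrite orb -(orb x) porbit_id.
  by case/porbitP=> i ->; rewrite -fconnect_orbit permX fconnect_iter.
exists (fingraph.orbit s ord0); last first.
  split=> //; have /card_uniqP <- := orbit_uniq s ord0.
  by rewrite (eq_card (B := 'I_m.+1)) ?card_ord // => x; rewrite full.
split=> /=; rewrite ?cats0 ?andbT.
- exact: orbit_uniq.
- by rewrite inE; apply: contraTneq (full ord0) => <-.
- by rewrite cycle_orbit //; apply: perm_inj.
by move=> x; rewrite full.
Qed.

Lemma exists_single_orbit m : (0 < m)%N -> exists s : 'S_m, #|porbits s| == 1%N.
Proof.
case: m => // m _; pose L := enum 'I_m.+1.
have U : uniq L by apply: enum_uniq.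
exists (perm (can_inj (prev_next U))).
apply/cards1P; exists (porbit (perm (can_inj (prev_next U))) ord0).
apply/setP=> X; rewrite inE; apply/imsetP/eqP => [[x _ ->]|->]; last by exists ord0.
apply/esym/eqP; rewrite eq_porbit_mem.
have cL : fcycle (perm (can_inj (prev_next U))) L.
  by apply: sub_cycle (cycle_next U) => y z /=; rewrite permE.
have /iter_findex <- : fconnect (perm (can_inj (prev_next U))) x ord0.
  by rewrite (fconnect_cycle cL) mem_enum.
by rewrite -permX mem_porbit.
Qed.

(** The scalar by which the creation operator of index m acts on traces.  There
    are (m - 1)! cycles of length m > 0 in S_m, so it is 1.  As it does not depend
    on n, being nonzero is enough to divide by it; the exact value at m = 1 makes
    the fixed points contribute no scalar. *)
Definition creation_coef (m : nat) : rat :=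
  (m * #|[pred s : 'S_m | #|porbits s| == 1%N]|)%:R / m`!%:R.

Lemma creation_coef1 : creation_coef 1 = 1.
Proof.
have [s s1] := @exists_single_orbit 1 isT.
rewrite /creation_coef (eq_card1 (x := s)) // => t; rewrite !inE.
have tE (t' : 'S_1) : t' = 1%g by apply/permP=> i; rewrite !ord1.
by rewrite (tE t) -(tE s) s1 eqxx.
Qed.

Lemma creation_coef_neq0 m : (0 < m)%N -> creation_coef m != 0.
Proof.
move=> m0; have [s s1] := exists_single_orbit m0.
rewrite mulf_neq0 ?invr_eq0 ?Num.Theory.pnatr_eq0 -?lt0n ?fact_gt0 // muln_gt0 m0.
by apply/card_gt0P; exists s.
Qed.

(** All the m-cycles s are conjugate, so each term of omega contributes the same
    trace. *)
Lemma creation_comp_perm_trace m k (c : 'S_m) (t : 'S_k) : (0 < m)%N ->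
  #|porbits c| == 1%N ->
  creation_comp m (perm_trace t) = creation_coef m *: perm_trace (perm_sum c t).
Proof.
move=> m0 c1; rewrite /creation_comp trace_galg_tensor.
have omegaE s : omega m s = if #|porbits s| == 1%N then m%:R else 0.
  rewrite galg_scaleE sum_ffunE; case: ifP => s1.
    rewrite (bigD1 s) //= big1 => [|s' /andP[_ /negPf s's]].
      by rewrite ffunE eqxx addr0 mulr1.
    by rewrite ffunE eq_sym s's.
  rewrite big1 ?mulr0 // => s' s'1; rewrite ffunE; case: eqP => // E.
  by rewrite -E s1 in s'1.
have [cc Dc [sc fc]] := single_orbit_disjoint_cycles m0 c1.
rewrite (bigID (fun s : 'S_m => #|porbits s| == 1%N)) /= [X in _ + X]big1 => [|s /negPf s1].
  rewrite addr0 (eq_bigr (fun=> (k`!%:R * m%:R) *: perm_trace (perm_sum c t))).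
    rewrite sumr_const -scaler_nat !scalerA; congr (_ *: _).
    rewrite /creation_coef !natrM invfM.
    have k0 : k`!%:R != 0 :> rat by rewrite Num.Theory.pnatr_eq0 -lt0n fact_gt0.
    have m0' : m`!%:R != 0 :> rat by rewrite Num.Theory.pnatr_eq0 -lt0n fact_gt0.
    by field; rewrite k0 m0'.
  move=> s s1; rewrite omegaE s1.
  have [cs Ds [ss fs]] := single_orbit_disjoint_cycles m0 s1.
  have [g ->] : exists g, s = (c ^ g)%g.
    apply: same_shape_conj Dc Ds _ _; last by rewrite /shape /= sc ss.
    by move=> x; rewrite /= cats0.
  by rewrite -[t in LHS]conjg1 perm_sumJ perm_traceJ.
by rewrite omegaE s1 mulr0 scale0r.
Qed.

Lemma disjoint_cycles_full n (s : 'S_n) css : disjoint_cycles s css ->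
  sumn (shape css) = n -> forall x, x \in flatten css.
Proof.
case=> U _ _ _; rewrite -size_flatten => sz x.
have := card_uniqP U; rewrite sz -[RHS](card_ord n) => /subset_cardP H.
by rewrite (H (subset_predT _)).
Qed.

Lemma exists_perm_shape ms : 0%N \notin ms ->
  exists (s : 'S_(sumn ms)) css, disjoint_cycles s css /\ shape css = ms.
Proof.
elim: ms => [|m ms IHms]; first by exists 1%g, [::]; split=> //; split=> // x; rewrite perm1.
rewrite inE negb_or eq_sym -lt0n => /andP[m0 /IHms[t [css [Dt sht]]]].
have [c c1] := exists_single_orbit m0.
have [cc Dc [sc fc]] := single_orbit_disjoint_cycles m0 c1.
exists (perm_sum c t), (map (map (lshift _)) [:: cc] ++ map (map (@rshift m _)) css).
split; first exact: disjoint_cycles_perm_sum.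
rewrite /shape /= size_map sc; congr (_ :: _).
by rewrite -map_comp -[RHS]sht; apply: eq_map => c' /=; rewrite size_map.
Qed.

Definition create (ms : seq nat) (v : fock) : fock :=
  foldr (fun m => creation m) v ms.

(** The trace depends on s only through its cycle type, so s can be replaced by a
    direct sum of a cycle and a permutation that has the remaining cycles. *)
Lemma create_vacuum ms n (s : 'S_n) css : disjoint_cycles s css ->
  shape css = ms -> sumn ms = n ->
  create ms vacuum = (\prod_(m <- ms) creation_coef m) *: fock_inj (perm_trace s).
Proof.
elim: ms n s css => [|m ms IHms] n s css D sh sn.
  subst n; rewrite big_nil scale1r /=; congr fock_inj.
  apply: val_inj; rewrite -[RHS]/(orbval _) perm_traceE.
  rewrite (eq_bigr (fun=> 1)) => [|h _]; first by rewrite sumr_const card_Sn.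
  by rewrite -galg_of1; congr galg_of; apply/permP=> -[].
have ms0 : 0%N \notin m :: ms.
  case: D => _ N _ _; apply: contra N; rewrite -sh => /mapP[c cin /esym/size0nil <-//].
have := ms0; rewrite inE negb_or eq_sym -lt0n => /andP[m0 /exists_perm_shape[t [css' [Dt sht]]]].
have [c c1] := exists_single_orbit m0.
have [cc Dc [sc fc]] := single_orbit_disjoint_cycles m0 c1.
rewrite /= (IHms _ t css') // linearZ /= creation_fock_inj.
rewrite (creation_comp_perm_trace t m0 c1) linearZ /= scalerA big_cons mulrC; congr (_ *: _).
subst n; congr fock_inj.
have [g ->] : exists g, s = (perm_sum c t ^ g)%g; last by rewrite perm_traceJ.
apply: same_shape_conj (disjoint_cycles_perm_sum Dc Dt) D _ _; last first.
  rewrite sh /shape /= size_map sc; congr (_ :: _).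
  by rewrite -map_comp -[RHS]sht; apply: eq_map => c' /=; rewrite size_map.
apply: disjoint_cycles_full (disjoint_cycles_perm_sum Dc Dt) _.
rewrite -size_flatten flatten_cat -!map_flatten size_cat !size_map /= cats0 sc.
by rewrite size_flatten sht.
Qed.

Lemma iter_creation1 j ms : iter j (creation 1) (create ms vacuum) =
  create (nseq j 1%N ++ ms) vacuum.
Proof. by elim: j => //= j ->. Qed.

Lemma reorder_shape (T : eqType) (css : seq (seq T)) ms : perm_eq (shape css) ms ->
  exists2 css', perm_eq css css' & shape css' = ms.
Proof.
elim: ms css => [|m ms IHms] css P.
  by exists [::] => //; move: (perm_size P) => /=; rewrite size_map => /size0nil ->.
have /mapP[c cin Em] : m \in shape css by rewrite (perm_mem P) mem_head.
have Pc := perm_to_rem cin.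
have := perm_trans (_ : perm_eq (m :: shape (rem c css)) (shape css)) P.
rewrite perm_cons {1}Em perm_sym => /(_ (perm_map size Pc))/IHms[css' P' <-].
exists (c :: css'); last by rewrite /= Em.
by apply: (perm_trans Pc); rewrite perm_cons.
Qed.

(** The points outside the image of f are fixed by [embed_perm injf s]; each of
    them is a cycle of length 1, produced by a creation operator of index 1. *)
Lemma unit_creation_create d (s : 'S_d) css ms n (f : 'I_d -> 'I_n)
    (injf : injective f) :
  disjoint_cycles s css -> sumn (shape css) = d -> perm_eq (shape css) ms ->
  unit_creation (n%:Z - (sumn ms)%:Z) (create ms vacuum) =
  ((n - d)`!%:R^-1 * \prod_(m <- ms) creation_coef m) *:
    fock_inj (perm_trace (embed_perm injf s)).
Proof.
move=> D sd /reorder_shape[css' P shm].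
have {}D := disjoint_cycles_perm P D.
have {}sd : sumn ms = d.
  by rewrite -shm; apply: etrans sd; apply/esym/perm_sumn/perm_map.
have dn : (d <= n)%N.
  by rewrite -[d]card_ord -[n]card_ord; apply: leq_card injf.
rewrite sd subzn // /unit_creation iter_creation1 -scalerA; congr (_ *: _).
pose F := enum [predC codom f].
have sF : size F = (n - d)%N.
  rewrite -cardE -[n in (n - _)%N]card_ord -[d in (_ - d)%N]card_ord -(card_codom injf).
  by rewrite -(cardC [in codom f]) addKn; apply: eq_card.
rewrite (create_vacuum (css := [seq [:: x] | x <- F] ++ map (map f) css')
    (s := embed_perm injf s)).
- rewrite big_cat /= big_nseq creation_coef1; congr (_ *: _).
  by rewrite -[RHS]mul1r; congr (_ * _); elim: (n - d)%N => //= j ->; rewrite mul1r.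
- have [U N C O] := disjoint_cycles_embed injf D; split.
  + rewrite flatten_cat flatten_seq1 cat_uniq enum_uniq U andbT; apply/hasP=> -[x].
    by rewrite -map_flatten => /mapP[a _ ->]; rewrite mem_enum inE codom_f.
  + by rewrite mem_cat negb_or N andbT; apply/mapP=> -[].
  + rewrite all_cat C andbT all_map; apply/allP=> x; rewrite mem_enum => xN /=.
    by rewrite embed_perm_out // eqxx.
  by move=> x; rewrite flatten_cat mem_cat negb_or => /andP[_ /O].
- rewrite /shape map_cat -!map_comp; congr (_ ++ _).
    by rewrite -sF; elim: F {sF} => //= x F ->.
  by rewrite -shm; apply: eq_map => c /=; rewrite size_map.
by rewrite sumn_cat sumn_nseq mul1n sd subnK.
Qed.

(** * Combinations of terms independent of the number of points *)

Lemma big_comp_creation (J : Type) (l : seq J) (F : J -> fock -> fock) v :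
  (\big[comp/id]_(j <- l) F j) v = foldr F v l.
Proof. by elim: l => [|j l IHl]; rewrite ?big_nil // big_cons /= IHl. Qed.

Lemma fock_termE s n (d : term_index s) :
  fock_term n d =
  unit_creation (n%:Z - (sumn (term_parts d))%:Z) (create (term_parts d) vacuum).
Proof.
rewrite /fock_term /term_parts; congr (unit_creation (_ - Posz _) _).
  rewrite sumn_flatten sumnE !big_map big_filter.
  by apply: eq_bigr => B _; rewrite sumnE.
rewrite -big_filter big_comp_creation.
by elim: (filter _ _) => //= B l ->; rewrite big_comp_creation /create foldr_cat.
Qed.

Section TermCombinations.
Variables (s : nat) (k : 'I_s -> nat).

Definition term_combination (F : nat -> fock) :=
  exists (N : nat) (c : 'I_N -> rat) (d : 'I_N -> term_index s),
    (forall a, admissible k (d a)) /\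
    (forall n, F n = \sum_(a < N) c a *: fock_term n (d a)).

Lemma term_combination0 : term_combination (fun=> 0).
Proof.
exists 0%N, (fun=> 0), (fun=> TermIndex set0 (fun=> 0%N) (fun=> 0%N) (fun=> [::])).
by split=> [[]|n] //; rewrite big_ord0.
Qed.

Lemma term_combination_term a d : admissible k d ->
  term_combination (fun n => a *: fock_term n d).
Proof. by move=> kd; exists 1%N, (fun=> a), (fun=> d); split=> // n; rewrite big_ord1. Qed.

Lemma term_combinationD F F' : term_combination F -> term_combination F' ->
  term_combination (fun n => F n + F' n).
Proof.
move=> [N [c [d [kd E]]]] [N' [c' [d' [kd' E']]]].
exists (N + N')%N, (fun a => match split a with inl i => c i | inr j => c' j end),
  (fun a => match split a with inl i => d i | inr j => d' j end).
split=> [a|n]; first by case: (split a).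
rewrite E E' big_split_ord /=; congr (_ + _); apply: eq_bigr => i _.
  by rewrite (unsplitK (inl i)).
by rewrite (unsplitK (inr i)).
Qed.

Lemma term_combinationZ a F : term_combination F ->
  term_combination (fun n => a *: F n).
Proof.
move=> [N [c [d [kd E]]]]; exists N, (fun i => a * c i), d; split=> // n.
by rewrite E scaler_sumr; apply: eq_bigr => i _; rewrite scalerA.
Qed.

Lemma eq_term_combination F F' : (forall n, F n = F' n) ->
  term_combination F -> term_combination F'.
Proof.
by move=> E [N [c [d [kd EF]]]]; exists N, c, d; split=> // n; rewrite -E.
Qed.

Lemma term_combination_sum (J : finType) (F : J -> nat -> fock) :
  (forall j, term_combination (F j)) -> term_combination (fun n => \sum_j F j n).
Proof.
move=> H; elim: (index_enum J) => [|j r IHr].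
  by apply: eq_term_combination term_combination0 => n; rewrite big_nil.
by apply: eq_term_combination (term_combinationD (H j) IHr) => n; rewrite big_cons.
Qed.

Definition support_bound := (\sum_(j < s) (k j + 1))%N.

Lemma configuration_bound d (g : 'S_d) bs :
  configuration k (index_enum 'I_s) setT g bs ->
  (d <= support_bound)%N /\ sumn (shape (flatten (unzip2 bs))) = d.
Proof.
case=> Pr _ [U _ _ _] EA bal.
have sz : size (flatten (flatten (unzip2 bs))) = d.
  have /card_uniqP <- := U; rewrite -[RHS](card_ord d); apply: eq_card => x.
  by rewrite -EA !inE.
split; last by rewrite -size_flatten.
rewrite -[leqLHS]sz /support_bound -(perm_big _ Pr) /=.
elim: bs bal {Pr U EA sz} => [|b bs IHbs] bal; first by rewrite big_nil.
rewrite /= flatten_cat size_cat big_cat /=; apply: leq_add.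
  by have [_] := bal b (mem_head _ _); rewrite big_split /= sum1_size.
by apply: IHbs => b' b'bs; apply: bal; rewrite inE b'bs orbT.
Qed.

Lemma configuration_fock_term d (g : 'S_d) bs :
  configuration k (index_enum 'I_s) setT g bs ->
  exists (a : rat) (t : term_index s), [/\ admissible k t,
    forall n (f : 'I_d -> 'I_n) (injf : injective f),
      fock_inj (perm_trace (embed_perm injf g)) =
      (n - d)`!%:R *: (a *: fock_term n t)
    & forall n, (n < d)%N -> fock_term n t = 0].
Proof.
move=> conf; have [kt Pt] := configuration_termP conf.
have [_ sd] := configuration_bound conf.
have [_ _ D _ _] := conf.
set t := configuration_term k bs in kt Pt.
pose a := \prod_(m <- term_parts t) creation_coef m.
have a0 : a != 0.
  rewrite prodf_seq_neq0; apply/allP=> m; rewrite (perm_mem Pt) => /mapP[c cin ->].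
  apply: creation_coef_neq0; rewrite lt0n size_eq0.
  by case: D => _ N _ _; apply: contraNneq N => <-.
exists a^-1, t; split=> // [n f injf|n nd]; rewrite fock_termE.
  rewrite (unit_creation_create injf D sd) 1?perm_sym // !scalerA -/a.
  rewrite [X in X *: _](_ : _ = 1) ?scale1r //; field.
  by rewrite a0 Num.Theory.pnatr_eq0 -lt0n fact_gt0.
rewrite (perm_sumn Pt) sd.
by have -> : n%:Z - d%:Z = Negz (d - n).-1 by rewrite NegzE; lia.
Qed.

(** The (n - d)! on the right is that of the operator 1_{-(n-d)}; the last two
    conclusions allow the sum over d to stop at a bound that does not depend
    on n. *)
Lemma trace_term_combination d (x : galg rat 'S_d) :
  (forall g, x g != 0 -> exists bs, configuration k (index_enum 'I_s) setT g bs) ->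
  exists F, [/\ term_combination F,
    forall n (f : 'I_d -> 'I_n) (injf : injective f),
      fock_inj (conj_trace (embed_galg injf x)) = (n - d)`!%:R *: F n,
    forall n, (n < d)%N -> F n = 0
    & (support_bound < d)%N -> forall n, F n = 0].
Proof.
move=> supp.
have /choice[F HF] (g : 'S_d) : exists F, [/\ term_combination F,
    forall n (f : 'I_d -> 'I_n) (injf : injective f),
      x g *: fock_inj (perm_trace (embed_perm injf g)) = (n - d)`!%:R *: F n,
    forall n, (n < d)%N -> F n = 0
    & (support_bound < d)%N -> forall n, F n = 0].
  have [->|xg] := eqVneq (x g) 0.
    exists (fun=> 0); split=> //; first exact: term_combination0.
    by move=> n f injf; rewrite scale0r scaler0.
  have [bs conf] := supp g xg.
  have [a [t [kt tE t0]]] := configuration_fock_term conf.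
  exists (fun n => x g *: (a *: fock_term n t)); split.
  - exact/term_combinationZ/term_combination_term.
  - by move=> n f injf; rewrite tE !scalerA [in LHS]mulrC mulrAC.
  - by move=> n nd; rewrite t0 // !scaler0.
  by have [le _] := configuration_bound conf; rewrite ltnNge le.
exists (fun n => \sum_g F g n); split.
- by apply: term_combination_sum => g; case: (HF g).
- move=> n f injf; rewrite linear_sum linear_sum scaler_sumr /=.
  by apply: eq_bigr => g _; case: (HF g) => _ /(_ n f injf) <- _ _; rewrite linearZ /= linearZ.
- by move=> n nd; rewrite big1 // => g _; case: (HF g) => _ _ ->.
by move=> ld n; rewrite big1 // => g _; case: (HF g) => _ _ _ ->.
Qed.
End TermCombinations.

Lemma enum_val_incr n (A : {set 'I_n}) :
  {mono @enum_val _ (mem A) : i j / (i < j)%N}.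
Proof.
have incr (i j : 'I_#|A|) : (i < j)%N -> (enum_val i < enum_val j)%N.
  have so : sorted ltn (map val (enum A)).
    have sub : subseq (map val (enum A)) (map val (enum 'I_n)).
      by apply: map_subseq; rewrite [enum A]/(enum_mem _) enumT filter_subseq.
    apply: (subseq_sorted ltn_trans sub).
    by rewrite val_enum_ord iota_ltn_sorted.
  move=> ij; have x0 := enum_val i.
  rewrite !(enum_val_nth x0) -!(nth_map x0 0%N val) -?cardE //.
  by apply: (sorted_ltn_nth ltn_trans) => //; rewrite inE size_map -cardE.
move=> i j; have [ij|ij|/val_inj ->] := ltngtP i j; last by rewrite ltnn.
  by rewrite incr.
by apply/negbTE; rewrite -leqNgt ltnW // incr.
Qed.

Lemma sum_ord_trunc (V : nmodType) (F : nat -> V) a b :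
  (forall i, (a <= i)%N -> F i = 0) -> (forall i, (b <= i)%N -> F i = 0) ->
  \sum_(i < a) F i = \sum_(i < b) F i.
Proof.
have H c c' : (forall i, (c <= i)%N -> F i = 0) -> (c <= c')%N ->
    \sum_(i < c) F i = \sum_(i < c') F i.
  move=> F0 cc'; rewrite (big_ord_widen c' F cc') [RHS](bigID (fun i : 'I_c' => i < c)%N) /=.
  by rewrite [X in _ = _ + X]big1 ?addr0 // => i; rewrite -leqNgt; apply: F0.
move=> Fa Fb; rewrite (H a (maxn a b)) ?leq_maxl //.
by rewrite (H b (maxn a b)) ?leq_maxr.
Qed.

Lemma jm_power_sums_expansion s n (k : 'I_s -> nat) :
  orbval (\prod_(j < s) jm_power_sum n (k j)) =
  subset_power_sums k (index_enum 'I_s) [set: 'I_n].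
Proof.
rewrite -[orbval _]/(val _) rmorph_prod /subset_power_sums; apply: eq_bigr => j _ /=.
apply: eq_big => [i|i _]; first by rewrite inE.
by congr ((- _) ^+ _); apply: eq_bigr => l _; rewrite inE.
Qed.

Theorem proposition4p6 (s : nat) (k : 'I_s -> nat) (hs : (0 < s)%N) :
  exists (N : nat) (c : 'I_N -> rat) (d : 'I_N -> term_index s),
    (forall a, admissible k (d a)) /\
    (forall n : nat, (0 < n)%N ->
       fock_inj (\prod_(j < s) jm_power_sum n (k j)) =
       \sum_(a < N) c a *: fock_term n (d a)).
Proof.
pose r := index_enum 'I_s.
pose c n := projT1 (cid2 (spanned_power_sums n k r)).
have cP n : expands_into (c n) (subset_power_sums k r).
  by rewrite /c; case: cid2.
have cQ n : supported (fun A g => exists bs, configuration k r A g bs) (c n).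
  by rewrite /c; case: cid2.
have /choice[F HF] := fun d => trace_term_combination (cQ d setT).
suff FE n : fock_inj (\prod_(j < s) jm_power_sum n (k j)) =
    \sum_(d < (support_bound k).+1) d`!%:R^-1 *: F d n.
  have [|N [a [t [kt E]]]] := @term_combination_sum _ k 'I_(support_bound k).+1
      (fun d n => d`!%:R^-1 *: F d n).
    by move=> d; apply: term_combinationZ; case: (HF d).
  by exists N, a, t; split=> // n _; rewrite FE E.
set Q := \prod_(j < s) _.
have fact0 m : m`!%:R != 0 :> rat by rewrite Num.Theory.pnatr_eq0 -lt0n fact_gt0.
have traceA (A : {set 'I_n}) :
    fock_inj (conj_trace (c n A)) = (n - #|A|)`!%:R *: F #|A| n.
  have [_ /(_ n _ (@enum_val_inj _ (mem A))) <- _ _] := HF #|A|; congr (fock_inj (conj_trace _)).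
  rewrite -(expansion_embed (@enum_val_inj _ (mem A)) (@enum_val_incr n A) (cP _) (cP n)).
  congr (c n _); apply/setP=> x; apply/idP/imsetP => [xA|[i _ ->]].
    by exists (enum_rank_in xA x); rewrite ?inE ?enum_rankK_in.
  exact: enum_valP.
(* There are 'C(n, d) supports of size d, and 'C(n, d) (n - d)! / n! = 1 / d!. *)
have -> : fock_inj Q = \sum_(d < n.+1) d`!%:R^-1 *: F d n.
  apply: (scalerI (fact0 n)); rewrite -linearZ /= -conj_trace_invariant.
  rewrite jm_power_sums_expansion (cP n) !linear_sum /=.
  rewrite (partition_big (fun A : {set 'I_n} => inord #|A| : 'I_n.+1) xpredT) //=.
  apply: eq_bigr => d _.
  rewrite (eq_big (fun A : {set 'I_n} => #|A| == d) (fun=> (n - d)`!%:R *: F d n)).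
  - rewrite sumr_const -cardsE card_draws card_ord -scaler_nat !scalerA; congr (_ *: _).
    have dn : (d <= n)%N by rewrite -ltnS.
    by rewrite -(bin_fact dn) !natrM; field; rewrite fact0.
  - move=> A; rewrite subsetT /= -(inj_eq val_inj) /= inordK // ltnS.
    by rewrite -[n in leqRHS]card_ord max_card.
  move=> A /andP[_ /eqP <-]; rewrite traceA inordK // ltnS.
  by rewrite -[n in leqRHS]card_ord max_card.
by apply: (@sum_ord_trunc _ (fun d => d`!%:R^-1 *: F d n)) => d dB;
  case: (HF d) => _ _ F1 F2; [rewrite F1 | rewrite F2]; rewrite ?scaler0.
Qed.
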